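(* Let $q$ be a prime power, let $\ell, m$ be integers with $2 \le \ell \le m-2$, and let $V_m$ be an $m$-dimensional vector space over $\mathbb{F}_q$. Put $$e(\ell,m) = {m \brack \ell}_q - q^{\ell(m-\ell)}, \qquad e'(\ell,m) = {m \brack \ell}_q - q^{\ell(m-\ell)} - q^{\ell(m-\ell)-2}.$$ If $\Pi$ is a hyperplane of $\mathbb{P}\left(\bigwedge^{\ell} V_m\right)$ with $|\Pi \cap G(\ell, V_m)| < e(\ell,m)$, then $|\Pi \cap G(\ell, V_m)| \le e'(\ell,m)$. Moreover, this bound is attained: there exists a hyperplane $\Pi$ of $\mathbb{P}\left(\bigwedge^{\ell} V_m\right)$ with $|\Pi \cap G(\ell, V_m)| = e'(\ell,m)$.
   Context: $G(\ell,V_m)$ denotes the Grassmannian of $\ell$-dimensional subspaces of $V_m$, identified with its image in the projective space $\mathbb{P}\left(\bigwedge^{\ell} V_m\right)$ under the Plücker embedding $L \mapsto [\omega_1 \wedge \cdots \wedge \omega_\ell]$, where $\omega_1,\dots,\omega_\ell$ is any basis of $L$. The quantity $|\Pi \cap G(\ell,V_m)|$ is the number of points of $G(\ell,V_m)$ lying on $\Pi$. The Gaussian binomial is ${m \brack \ell}_q = \prod_{i=0}^{\ell-1}\frac{q^m - q^i}{q^\ell - q^i}$, which equals $|G(\ell,V_m)|$. *)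

(* Defs.v *)
From HB Require Import structures.
From mathcomp Require Import all_boot all_order all_algebra all_field.

Set Implicit Arguments.
Unset Strict Implicit.
Unset Printing Implicit Defensive.

Import GRing.Theory.
Local Open Scope ring_scope.

HB.instance Definition _ (F : finFieldType) (V : vectType F) :=
  isCountable.Build {vspace V}
    (pcan_pickleK (can_pcan (@VectorInternalTheory.vs2mxK F V))).
HB.instance Definition _ (F : finFieldType) (V : vectType F) :=
  isFinite.Build {vspace V}
    (pcan_enumP (can_pcan (@VectorInternalTheory.vs2mxK F V))).

Section ExteriorPower.

Variables (F : finFieldType) (V : vectType F) (l : nat).
Implicit Types (w : {ffun 'I_l -> V}) (i j : 'I_l).

Definition update w i (x : V) : {ffun 'I_l -> V} :=
  [ffun j => if j == i then x else w j].

Definition multilinear (U : vectType F) (f : {ffun 'I_l -> V} -> U) : Prop :=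
  forall w i (a : F) (x y : V),
    f (update w i (a *: x + y)) = a *: f (update w i x) + f (update w i y).

Definition alternating (U : vectType F) (f : {ffun 'I_l -> V} -> U) : Prop :=
  forall w i j, i != j -> w i = w j -> f w = 0.

(* The l-th exterior power is given by its universal property: W, together with
   wedge w = w_1 /\ ... /\ w_l, is a model of it.  Models are unique up to a
   unique isomorphism; [exterior_power_exists] below constructs one. *)
Definition is_exterior_power (W : vectType F) (wedge : {ffun 'I_l -> V} -> W)
    : Prop :=
  [/\ multilinear wedge, alternating wedge
    & forall (U : vectType F) (f : {ffun 'I_l -> V} -> U),
        multilinear f -> alternating f ->
        exists! g : 'Hom(W, U), forall w, g (wedge w) = f w].

(* A subspace <[x]> of W with x != 0 is a point of P(W).  The nth default is
   never reached when \dim L = l. *)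
Definition plucker (W : vectType F) (wedge : {ffun 'I_l -> V} -> W)
    (L : {vspace V}) : {vspace W} :=
  <[wedge [ffun i : 'I_l => (vbasis L)`_i]]>%VS.

Definition grassmannian (W : vectType F) (wedge : {ffun 'I_l -> V} -> W)
    : {set {vspace W}} :=
  [set plucker wedge L | L : {vspace V} & \dim L == l].

End ExteriorPower.

(* A hyperplane of P(W) is P(H) for a linear subspace H of codimension 1. *)
Definition hyperplane (F : fieldType) (W : vectType F) (H : {vspace W}) : Prop :=
  (\dim H).+1 = \dim {:W}.

Definition points_on (F : finFieldType) (W : vectType F)
    (H : {vspace W}) (X : {set {vspace W}}) : {set {vspace W}} :=
  [set P in X | (P <= H)%VS].

Definition gauss_binomial (q m l : nat) : rat :=
  \prod_(i < l) ((q%:R ^+ m - q%:R ^+ i) / (q%:R ^+ l - q%:R ^+ i)).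

Definition e_bound (q l m : nat) : rat :=
  gauss_binomial q m l - q%:R ^+ (l * (m - l)).

Definition e'_bound (q l m : nat) : rat :=
  gauss_binomial q m l - q%:R ^+ (l * (m - l)) - q%:R ^+ (l * (m - l) - 2).

(* The model is the textbook one: the free space on V^l modulo the subspace
   spanned by the relations of multilinearity and alternation. *)
Section Construction.

Variables (F : finFieldType) (V : vectType F) (l : nat).

Local Notation fV := (finvect_type V).
Local Notation X := {ffun 'I_l -> fV}.
Local Notation T := {ffun X -> F^o}.

Let gen (w : {ffun 'I_l -> V}) : T := [ffun x : X => ((x == w :> X)%:R : F)].

Let lin_rel (r : X * 'I_l * F * fV * fV) : T :=
  let: (w, i, a, x, y) := r in
  gen (update (w : {ffun 'I_l -> V}) i (a *: (x : V) + (y : V)))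
  - (a *: gen (update (w : {ffun 'I_l -> V}) i (x : V))
     + gen (update (w : {ffun 'I_l -> V}) i (y : V))).

Let alt_rel (r : X * 'I_l * 'I_l) : T :=
  let: (w, i, j) := r in
  if (i != j) && (w i == w j) then gen (w : {ffun 'I_l -> V}) else 0.

Let R : {vspace T} := <<codom lin_rel ++ codom alt_rel>>%VS.

Let Q : vectType F := subvs_of (R^C)%VS.

Let addC t : daddv_pi (R^C)%VS R t + daddv_pi R (R^C)%VS t = t.
Proof.
apply: daddv_pi_add; first by rewrite capvC capv_compl.
by rewrite addvC addv_complf memvf.
Qed.

Let pr : {linear T -> Q} := vsproj (R^C)%VS \o daddv_pi (R^C)%VS R.

Let pr_rel t : t \in R -> pr t = 0.
Proof.
move=> tR; suff p0 : daddv_pi (R^C)%VS R t = 0 by rewrite /pr /= p0 linear0.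
have := addC t; rewrite (daddv_pi_id (capv_compl R) tR) => /eqP.
by rewrite -subr_eq0 addrK => /eqP.
Qed.

Let wedge (w : {ffun 'I_l -> V}) : Q := pr (gen w).

Let gen_sum (t : T) : t = \sum_x t x *: gen x.
Proof.
apply/ffunP => y; rewrite sum_ffunE (bigD1 y) //= big1 => [|x /negPf xy].
  by rewrite !ffunE eqxx [_ *: _]mulr1 addr0.
by rewrite !ffunE eq_sym xy [_ *: _]mulr0.
Qed.

Lemma exterior_power_exists :
  exists (W : vectType F) (wedge : {ffun 'I_l -> V} -> W),
    is_exterior_power wedge.
Proof.
exists Q, wedge; split.
- move=> w i a x y; apply/eqP; rewrite -subr_eq0 /wedge -linearZ -linearD.
  rewrite -linearB; apply/eqP/pr_rel/memv_span; rewrite mem_cat.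
  apply/orP; left.
  exact: (codom_f lin_rel (w : X, i, a, x : fV, y : fV)).
- move=> w i j ij wij; apply/pr_rel/memv_span; rewrite mem_cat.
  apply/orP; right.
  have := codom_f alt_rel (w : X, i, j).
  by rewrite /alt_rel /= ij /= (introT eqP (wij : w i = w j :> fV)).
move=> U f fM fA.
pose h (t : T) : U := \sum_(x : X) t x *: f x.
have h_lin : linear h.
  move=> a s t; rewrite /h scaler_sumr -big_split /=.
  by apply: eq_bigr => x _; rewrite !ffunE scalerDl scalerA.
pose hL := HB.pack_for {linear T -> U} h (GRing.isLinear.Build _ _ _ _ h h_lin).
pose k : 'Hom(T, U) := linfun hL.
have kE t : k t = h t by rewrite lfunE.
have kgen w : k (gen w) = f w.
  rewrite kE /h (bigD1 (w : X)) //= big1 => [|x /negPf xw].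
    by rewrite ffunE eqxx scale1r addr0.
  by rewrite ffunE xw scale0r.
have kR t : t \in R -> k t = 0.
  suff : (R <= lker k)%VS by move=> /subvP sR /sR; rewrite memv_ker => /eqP.
  apply/span_subvP => r; rewrite mem_cat memv_ker => /orP[] /codomP[].
    move=> [[[[w i] a] x] y] ->.
    by rewrite /lin_rel linearB linearD linearZ /= !kgen fM subrr.
  move=> [[w i] j] ->; rewrite /alt_rel.
  by case: ifP => [/andP[ij /eqP wij]|_]; rewrite ?linear0 // kgen (fA w i j).
have kwedge w : linfun (k \o vsval)%FUN (wedge w) = f w.
  rewrite lfunE /= vsprojK ?memv_pi // -[RHS]kgen -[in RHS](addC (gen w)).
  by rewrite linearD /= [X in _ + X]kR ?addr0 ?memv_pi.
exists (linfun (k \o vsval)%FUN); split=> // g gE.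
apply/lfunP => u.
have <- : pr (vsval u) = u.
  apply: val_inj; rewrite /= daddv_pi_id ?subvsP //; last by rewrite capvC capv_compl.
  by rewrite vsprojK ?subvsP.
rewrite [vsval u]gen_sum !linear_sum /=; apply: eq_bigr => x _.
by rewrite !linearZ /= -!/(wedge x) kwedge gE.
Qed.

End Construction.

(* Main.v *)
(* Hyperplanes are kernels of alternating l-forms f, and the points of G(l,V) off the
   hyperplane are the l-subspaces L with f|_L <> 0.  Let A(f) be the number of l-tuples on
   which f does not vanish, i.e. |GL_l(q)| times the number of those L; then A(f) is the sum
   over v in V of A(f_v), with f_v = f(v, ...).  If rad f has codimension l (f decomposable)
   this gives by induction the number q^(l(m-l)) of subspaces L, and it is a lower bound for
   every nonzero f.

   If f is not decomposable, rad f has codimension at least l + 2, and the induction yields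
   q^(l(m-l)) + q^(l(m-l)-2) provided at most q^(m-l+2) vectors v have f_v decomposable.  To
   see this, fix such a v outside rad f and put K = rad f_v, of codimension l - 1.  For any
   other such w outside K, w lies in rad(f|_P) for all hyperplanes P containing K and w.
   Either some pencil of hyperplanes through K contains no P with f|_P = 0, and the radicals
   of the q + 1 restrictions f|_P together with K contain all such w; or all of them lie in
   the intersection of the hyperplanes P through K with f|_P = 0, which exceeds K by at most
   one dimension.  Equality holds for xi_1 /\ ... /\ xi_(l-2) /\ (a /\ b + c /\ d). *)
Require Import Defs.
From HB Require Import structures.
From mathcomp Require Import all_boot all_order all_algebra all_field.
From mathcomp Require Import zify.

Set Implicit Arguments.
Unset Strict Implicit.
Unset Printing Implicit Defensive.

Import Order.TTheory GRing.Theory Num.Theory.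
Local Open Scope ring_scope.

(** * Alternating forms and their radicals *)

Section Forms.

Variables (F : finFieldType) (V : vectType F).
Local Notation fV := (finvect_type V).
Implicit Types (f g : seq V -> F) (U P K Y : {vspace V}) (s t : seq V).

Lemma dim_add_line U x : x \notin U -> \dim (<[x]> + U) = (\dim U).+1.
Proof.
move=> xU; rewrite dimv_disjoint_sum ?dim_vline.
  by rewrite (_ : x != 0) //; apply: contraNneq xU => ->; rewrite mem0v.
apply/eqP; rewrite -subv0; apply/subvP => y; rewrite memv_cap memv0.
by case/andP => /vlineP[k ->]; rewrite rpredZeq (negPf xU) orbF => /eqP->; rewrite scale0r.
Qed.

Lemma hyperplane_avoiding U P x : (U <= P)%VS -> x \in P -> x \notin U ->
  exists Y, [/\ (U <= Y)%VS, (Y <= P)%VS, x \notin Y & (\dim Y).+1 = \dim P].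
Proof.
move=> UP xP xU; pose A := (U + <[x]>)%VS; pose C := (P :\: A)%VS.
have AP : (A <= P)%VS by rewrite subv_add UP -memvE.
have CA : (C :&: A = 0)%VS by rewrite capv_diff.
have UC : (U :&: C = 0)%VS.
  apply/eqP; rewrite -subv0 -CA capvC; apply: capvS => //; exact: addvSl.
have dA : \dim A = (\dim U).+1 by rewrite /A addvC dim_add_line.
have dC : (\dim A + \dim C)%N = \dim P.
  by rewrite -(dimv_cap_compl P A) (capv_idPr AP).
exists (U + C)%VS; split.
- exact: addvSl.
- by rewrite subv_add UP diffvSl.
- apply/negP=> /memv_addP[u uU [c cC xuc]].
  have cA : c \in A.
    have -> : c = - u + x by rewrite xuc addKr.
    by apply: memv_add; rewrite ?memvN // memv_line.
  have : c \in (C :&: A)%VS by rewrite memv_cap cC.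
  by rewrite CA memv0 => /eqP c0; move: xU; rewrite xuc c0 addr0 uU.
by rewrite dimv_disjoint_sum //; lia.
Qed.

Lemma sub_hyperplane U : U != fullv ->
  exists2 P, (U <= P)%VS & (\dim P).+1 = \dim {:V}.
Proof.
rewrite eqEsubv subvf /= => /subvPn[x _ xU].
have [Y [UY _ _ dY]] := hyperplane_avoiding (subvf U) (memvf x) xU.
by exists Y.
Qed.

(** Forms live on all sequences, and only those of length [l] are constrained; contraction is then a
    mere cons, without casts between tuple types. *)
Definition altform (l : nat) f : Prop :=
  (forall s1 s2 a x y, (size s1 + size s2).+1 = l ->
    f (s1 ++ (a *: x + y) :: s2) = a * f (s1 ++ x :: s2) + f (s1 ++ y :: s2))
  /\ (forall s, size s = l -> ~~ uniq s -> f s = 0).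

Definition contr f (v : V) : seq V -> F := fun s => f (v :: s).

Lemma altform_contr l f v : altform l.+1 f -> altform l (contr f v).
Proof.
case=> fL fA; split=> [s1 s2 a x y sz|s sz nu]; rewrite /contr.
  by apply: (fL (v :: s1)); rewrite /= addSn sz.
by apply: fA; rewrite /= ?sz // (negPf nu) andbF.
Qed.

Lemma altform_headL l f : altform l.+1 f -> forall s a x y, size s = l ->
  f ((a *: x + y) :: s) = a * f (x :: s) + f (y :: s).
Proof. by case=> fL _ s a x y sz; apply: (fL [::]); rewrite /= add0n sz. Qed.

Lemma altform_head0 l f : altform l.+1 f -> forall s, size s = l -> f (0 :: s) = 0.
Proof.
move=> fF s sz; have := altform_headL fF (-1) 0 0 sz.
by rewrite scaleN1r oppr0 addr0 mulN1r addNr.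
Qed.

Lemma altform_headZ l f : altform l.+1 f -> forall s a x, size s = l ->
  f ((a *: x) :: s) = a * f (x :: s).
Proof.
by move=> fF s a x sz; rewrite -[a *: x]addr0 (altform_headL fF) // (altform_head0 fF) // addr0.
Qed.

Lemma altform_headD l f : altform l.+1 f -> forall s x y, size s = l ->
  f ((x + y) :: s) = f (x :: s) + f (y :: s).
Proof.
by move=> fF s x y sz; rewrite -[x]scale1r (altform_headL fF) // mul1r scale1r.
Qed.

Lemma altform_head_sum l f (I : Type) (r : seq I) (c : I -> F) (x : I -> V) :
  altform l.+1 f -> forall s, size s = l ->
  f ((\sum_(i <- r) c i *: x i) :: s) = \sum_(i <- r) c i * f (x i :: s).
Proof.
move=> fF s sz; elim: r => [|i r IH]; first by rewrite !big_nil (altform_head0 fF).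
by rewrite !big_cons (altform_headL fF) // IH.
Qed.

Lemma altform_swap l f : altform l.+2 f -> forall s x y, size s = l ->
  f (x :: y :: s) = - f (y :: x :: s).
Proof.
move=> fF s x y sz; apply/eqP; rewrite -addr_eq0; apply/eqP.
have sz1 z : size (z :: s) = l.+1 by rewrite /= sz.
have fA z : f (z :: z :: s) = 0 by case: fF => _; apply; rewrite /= ?sz ?inE ?eqxx.
have := fA (x + y); rewrite (altform_headD fF) ?sz1 // -![f (_ :: (x + y) :: s)]/(contr f _ _).
rewrite !(altform_headD (altform_contr _ fF)) // /contr !fA add0r addr0 => <-.
by rewrite addrC.
Qed.

Lemma mem_cat_cons (x : V) s : x \in s -> exists s1 s2 : seq V, s = s1 ++ x :: s2.
Proof. by case/splitPr => s1 s2; exists s1, s2. Qed.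

(** Moving an entry costs a sign, which is not tracked since only vanishing matters. *)
Lemma altform_move l f : altform l f -> forall s1 x s2, (size s1 + size s2).+1 = l ->
  f (s1 ++ x :: s2) = 0 <-> f (x :: s1 ++ s2) = 0.
Proof.
elim: l f => [|l IH] f fF s1 x s2 //.
case: s1 => [|a s1] //= [sz].
have sz' : size (s1 ++ s2) = l.-1 by rewrite size_cat; lia.
case: l sz IH fF sz' => [|l] sz IH fF sz'; first by lia.
rewrite (altform_swap fF) ?sz' //.
have := IH _ (altform_contr a fF) s1 x s2 (ltac:(lia)).
rewrite /contr => ->; split; first by move->; rewrite oppr0.
by move/eqP; rewrite oppr_eq0 => /eqP.
Qed.

Lemma altform_perm l f : altform l f -> forall s t, size s = l -> perm_eq s t ->
  f s = 0 -> f t = 0.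
Proof.
elim: l f => [|l IH] f fF s t sz st.
  by move/size0nil: sz st => ->; rewrite perm_sym => /perm_nilP ->.
have szt : size t = l.+1 by rewrite -(perm_size st).
case: t szt st => [//|x t] [szt] st.
have /mem_cat_cons[s1 [s2 es]] : x \in s by rewrite (perm_mem st) inE eqxx.
subst s; have sz12 : (size s1 + size s2)%N = l by move: sz; rewrite size_cat /=; lia.
move/(altform_move fF _ (congr1 S sz12)) => f0.
apply: (IH _ (altform_contr x fF) (s1 ++ s2)) => //; first by rewrite size_cat.
by rewrite -(perm_cons x) -(permPr st) perm_sym -[x :: s2]cat1s perm_catCA.
Qed.

(** Multilinear expansion, one entry at a time: the head is written in [G], and the induction
    hypothesis applies to the contraction by each generator. *)
Lemma altform_span_eq0 l f (G : seq V) : altform l f ->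
  (forall s, size s = l -> {subset s <= G} -> f s = 0) ->
  forall s, size s = l -> {subset s <= <<G>>%VS} -> f s = 0.
Proof.
elim: l f => [|l IH] f fF fG s sz sG.
  by apply: fG; rewrite // (size0nil sz).
have genx x : x \in G -> forall t, size t = l -> {subset t <= <<G>>%VS} -> f (x :: t) = 0.
  move=> xG; apply: (IH _ (altform_contr x fF)) => t szt tG.
  by apply: fG => /= [|y]; rewrite ?szt // inE => /predU1P[->|/tG].
case: s sz sG => [//|x s] [sz] sG.
have xG : x \in <<G>>%VS by apply: sG; rewrite inE eqxx.
have ssG : {subset s <= <<G>>%VS} by move=> y ys; apply: sG; rewrite inE ys orbT.
have [k -> _] : {k : 'I_(size G) -> F | x = \sum_i k i *: G`_i & true}.
  exists (fun i => coord (in_tuple G) i x) => //.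
  exact: (@coord_span _ _ _ (in_tuple G)).
rewrite (altform_head_sum _ _ _ fF) // big1 // => i _.
by rewrite genx ?mulr0 // mem_nth.
Qed.

(** Boolean because [V] is finite, which allows case analysis and the counting of subspaces. *)
Definition vanishes (l : nat) f P :=
  [forall t : l.-tuple fV, all (fun x : V => x \in P) t ==> (f t == 0)].

Lemma vanishesP l f P :
  reflect (forall s, size s = l -> {subset s <= P} -> f s = 0) (vanishes l f P).
Proof.
apply: (iffP forallP) => [h s /eqP sz sP|h t].
  by apply/eqP; apply: (implyP (h (Tuple sz : l.-tuple fV))); apply/allP.
by apply/implyP => /allP tP; apply/eqP/h; rewrite ?size_tuple.
Qed.

Lemma nvanishesP l f P :
  reflect (exists s, [/\ size s = l, {subset s <= P} & f s != 0])
          (~~ vanishes l f P).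
Proof.
apply: (iffP idP) => [|[s [sz sP fs]]].
  case/forallPn => t; rewrite negb_imply => /andP[/allP tP ft].
  by exists t; rewrite size_tuple.
by apply/negP => /vanishesP h; rewrite h ?eqxx in fs.
Qed.

(** A sequence of [l] members of [e] either has a repetition or is a permutation of [e]. *)
Lemma vanishes_span l f e : altform l f -> size e = l -> f e = 0 -> vanishes l f <<e>>%VS.
Proof.
move=> fF sze fe; apply/vanishesP; apply: altform_span_eq0 => // s sz se.
have [us|nus] := boolP (uniq s); last by case: fF => _; apply.
have [|uE se'] := uniq_min_size us se; first by rewrite sz sze.
apply: (altform_perm fF _ _ fe) => //; rewrite perm_sym uniq_perm //.
by rewrite -(eq_uniq uE se').
Qed.

(** The radical of the restriction of [f] to [P]. The span makes it a subspace without any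
    hypothesis; for an alternating form of positive degree it adds nothing, by [memv_radical]. *)
Definition radical (l : nat) f P : {vspace V} :=
  <<[seq v : V <- enum fV | (v \in P) && vanishes l.-1 (contr f v) P]>>%VS.

Lemma memv_radical l f P v : altform l.+1 f ->
  (v \in radical l.+1 f P) = (v \in P) && vanishes l (contr f v) P.
Proof.
move=> fF; apply/idP/idP => [|/andP[vP vv]]; last first.
  have venum : (v : fV) \in enum fV by rewrite mem_enum.
  by apply: memv_span; rewrite mem_filter vP vv /=; exact: venum.
pose G := [seq v : V <- enum fV | (v \in P) && vanishes l (contr f v) P].
have GP : {subset G <= P} by move=> x; rewrite mem_filter => /andP[/andP[]].
move=> vG; apply/andP; split; first by move: vG; apply/subvP/span_subvP.
apply/vanishesP => s sz sP.
have [k -> _] : {k : 'I_(size G) -> F | v = \sum_i k i *: G`_i & true}.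
  exists (fun i => coord (in_tuple G) i v) => //.
  exact: (@coord_span _ _ _ (in_tuple G)).
rewrite /contr (altform_head_sum _ _ _ fF) // big1 // => i _.
have : G`_i \in G by rewrite mem_nth.
rewrite mem_filter => /andP[/andP[_ /vanishesP h] _].
by rewrite (_ : f _ = 0) ?mulr0 //; apply: h.
Qed.

Lemma radical_sub l f P : altform l.+1 f -> (radical l.+1 f P <= P)%VS.
Proof. by move=> fF; apply/subvP => x; rewrite memv_radical // => /andP[]. Qed.

Lemma radicalP l f v : altform l.+1 f ->
  reflect (forall s, size s = l -> f (v :: s) = 0) (v \in radical l.+1 f fullv).
Proof.
move=> fF; rewrite memv_radical // memvf; apply: (iffP (vanishesP _ _ _)) => h s sz.
  by apply: h => // x _; rewrite memvf.
by move=> _; apply: h.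
Qed.

(** In a sequence taken from bases of [U] and [Y], either some entry comes from [U] and is moved to
    the front, or all lie in [Y]. *)
Lemma vanishes_add l f U Y : altform l.+1 f -> vanishes l.+1 f Y ->
  (forall u, u \in U -> forall t, size t = l -> {subset t <= [predU (mem U) & (mem Y)]} ->
     f (u :: t) = 0) ->
  vanishes l.+1 f (U + Y)%VS.
Proof.
move=> fF /vanishesP fY fU; apply/vanishesP.
have -> : (U + Y)%VS = <<vbasis U ++ vbasis Y>>%VS.
  by rewrite span_cat !(span_basis (vbasisP _)).
apply: altform_span_eq0 => // s sz sG.
have [/hasP[u us uU]|/hasPn nU] := boolP (has (mem U) s).
  have [s1 [s2 es]] := mem_cat_cons us; subst s.
  have sz' : (size s1 + size s2)%N = l by move: sz; rewrite size_cat /=; lia.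
  apply/(altform_move fF); rewrite ?sz' //; apply: fU => //; first by rewrite size_cat.
  move=> x xs; have : x \in s1 ++ u :: s2.
    by move: xs; rewrite !mem_cat inE => /orP[] ->; rewrite ?orbT.
  move/sG; rewrite mem_cat inE /= => /orP[] /vbasis_mem ->; rewrite ?orbT //.
apply: fY => // x xs; have := nU _ xs; move: (sG _ xs); rewrite mem_cat.
by case/orP => /vbasis_mem // /= ->.
Qed.

(** If [U] had codimension at most [l] in [P], then [f] would vanish on a complement [C] of [U], as
    [l.+1] entries from a basis of [C] repeat, and hence on [U + C = P]. *)
Lemma dim_radical_le l f P U : altform l.+1 f -> ~~ vanishes l.+1 f P -> (U <= P)%VS ->
  (forall u, u \in U -> forall t, size t = l -> {subset t <= P} -> f (u :: t) = 0) ->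
  (\dim U + l.+1 <= \dim P)%N.
Proof.
move=> fF nv UP fU; rewrite leqNgt; apply: contra nv => dU.
pose C := (P :\: U)%VS.
have dC : (\dim U + \dim C)%N = \dim P by rewrite -(dimv_cap_compl P U) (capv_idPr UP).
have -> : P = (U + C)%VS by rewrite addvC addv_diff (addv_idPl UP).
have CP : (C <= P)%VS by exact: diffvSl.
apply: vanishes_add => //; last first.
  move=> u uU t sz tP; apply: fU => // x /tP /orP[] /= xx.
    exact: (subvP UP).
  exact: (subvP CP).
apply/vanishesP; rewrite -(span_basis (vbasisP C)); apply: altform_span_eq0 => // s sz sC.
case: fF => _ fA; apply: fA => //; apply/negP => us.
by have := uniq_leq_size us sC; rewrite sz size_tuple; lia.
Qed.

Lemma dim_radical_le_support l f s : altform l.+1 f -> size s = l.+1 -> f s != 0 ->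
  (\dim (radical l.+1 f fullv) + l.+1 <= \dim {:V})%N.
Proof.
move=> fF sz fs; apply: (dim_radical_le fF); rewrite ?subvf //.
  by apply/nvanishesP; exists s; split=> // x; rewrite memvf.
by move=> u /(radicalP _ fF) h t szt _; exact: h.
Qed.

End Forms.

(** * Decomposable contractions *)

Lemma card_fvspace (F : finFieldType) (V : vectType F) (U : {vspace V}) :
  #|[set x : finvect_type V | (x : V) \in U]| = (#|F| ^ \dim U)%N.
Proof.
case: V U => T c U.
rewrite -[RHS](@card_vspace F (finvect_type (Vector.Pack c)) c U).
by apply: eq_card => x; rewrite inE.
Qed.

Section Decomposable.

Variables (F : finFieldType) (V : vectType F).
Local Notation fV := (finvect_type V).
Local Notation m := (\dim {:V}).
Implicit Types (f g : seq V -> F) (U P K Y : {vspace V}) (s t : seq V).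

(* A nonzero l-form is a decomposable element of the exterior power of the dual
   space exactly when its radical has codimension l; the zero form is included. *)
Definition decomposable (l : nat) f := (m <= \dim (radical l f fullv) + l)%N.

Lemma nondecomposable_neq0 l f : altform l.+1 f -> ~~ decomposable l.+1 f ->
  ~~ vanishes l.+1 f fullv.
Proof.
move=> fF; apply: contra => /vanishesP f0; rewrite /decomposable.
suff -> : radical l.+1 f fullv = fullv by rewrite leq_addr.
apply/eqP; rewrite eqEsubv subvf; apply/subvP => x _; apply/radicalP => // s sz.
by apply: f0 => [|y]; rewrite /= ?sz ?memvf.
Qed.

Lemma dim_radical_fullv l f : altform l.+1 f -> ~~ vanishes l.+1 f fullv ->
  (\dim (radical l.+1 f fullv) + l.+1 <= m)%N.
Proof. by move=> fF /nvanishesP[s [sz _ fs]]; exact: dim_radical_le_support fF sz fs. Qed.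

Lemma dim_radical_decomposable l f : altform l.+1 f -> ~~ vanishes l.+1 f fullv ->
  decomposable l.+1 f -> (\dim (radical l.+1 f fullv) + l.+1)%N = m.
Proof.
by move=> fF nv df; apply/eqP; rewrite eqn_leq dim_radical_fullv.
Qed.

(** For [u], [x] in [K], the value of [g] at [u], [x] and [k - 1] further vectors is 0, all of them
    lying in a hyperplane through [K]. So the contraction by [x] is determined by its value on a
    basis of a complement of [K], and vanishes under one linear condition on [x]. *)
Lemma dim_radical_hyperplanes k g K : altform k.+1 g -> (\dim K + k)%N = m ->
  (forall P, (K <= P)%VS -> (\dim P).+1 = m -> vanishes k.+1 g P) ->
  (\dim K <= (\dim (radical k.+1 g fullv)).+1)%N.
Proof.
move=> gF dK gK; pose e := vbasis (K^C)%VS.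
have sze : size e = k by rewrite size_tuple dimv_compl; lia.
pose phi (x : V) : F^o := g (x :: e).
have phi_lin : linear phi by move=> a x y; apply: (altform_headL gF).
pose phiL := HB.pack_for {linear V -> F^o} phi (GRing.isLinear.Build _ _ _ _ phi phi_lin).
pose K' := (K :&: lker (linfun phiL))%VS.
have dK' : (\dim K <= (\dim K').+1)%N.
  rewrite -(limg_ker_dim (linfun phiL) K) -addn1 leq_add2l.
  by rewrite (leq_trans (dimvS (subvf _))) // dimvf.
apply: (leq_trans dK'); rewrite ltnS; apply: dimvS; apply/subvP => x.
rewrite memv_cap memv_ker lfunE /= /phi => /andP[xK /eqP gxe].
rewrite memv_radical // memvf /=.
case: k gF dK gK sze => [|k] gF dK gK sze.
  apply/vanishesP => s /size0nil -> _; rewrite /contr.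
  by rewrite (size0nil sze) in gxe.
have -> : fullv = (K + K^C)%VS by rewrite addv_complf.
have hF := altform_contr x gF; apply: vanishes_add => //.
  by rewrite -(span_basis (vbasisP (K^C)%VS)); exact: vanishes_span.
move=> u uK t sz _; rewrite /contr.
have [|P KP dP] := @sub_hyperplane _ _ (K + <<t>>)%VS.
  apply/eqP => KtV; have := dim_span t; have := dimv_add_leqif K <<t>>%VS.
  rewrite KtV sz => -[le1 _] le2.
  by have := leq_trans le1 (leq_add (leqnn _) le2); rewrite -dK; lia.
have sKP : (K <= P)%VS := subv_trans (addvSl _ _) KP.
have stP : (<<t>> <= P)%VS := subv_trans (addvSr _ _) KP.
apply: (vanishesP _ _ _ (gK P sKP dP)) => [|y]; first by rewrite /= sz.
rewrite !inE => /or3P[/eqP->|/eqP->|yt]; try exact: (subvP sKP).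
by apply: (subvP stP); apply: memv_span.
Qed.

Lemma add_line_hyperplane P w : (\dim P).+1 = m -> w \notin P ->
  (<[w]> + P)%VS = fullv.
Proof.
move=> dP wP; apply/eqP; rewrite eqEdim subvf /= -dP ltnNge; apply: contra wP => d.
have /eqP -> : P == (<[w]> + P)%VS by rewrite eqEdim addvSr.
by rewrite memvE addvSl.
Qed.

Lemma hyperplane_split P P1 w : (\dim P1).+1 = m -> w \in P -> w \notin P1 ->
  P = (<[w]> + (P1 :&: P))%VS.
Proof.
move=> dP1 wP wP1; rewrite vspace_modl -?memvE //.
by rewrite add_line_hyperplane // capfv.
Qed.

Lemma vanishes_add_line l f Y z : altform l.+1 f -> vanishes l.+1 f Y ->
  vanishes l (contr f z) Y -> vanishes l.+1 f (<[z]> + Y)%VS.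
Proof.
move=> fF fY fzY.
have h : vanishes l (contr f z) (<[z]> + Y)%VS.
  case: l fF fY fzY => [|l] fF fY fzY.
    apply/vanishesP => s sz _; apply: (vanishesP _ _ _ fzY) => //.
    by rewrite (size0nil sz).
  apply: vanishes_add => //; first exact: altform_contr.
  move=> u /vlineP[k ->] t sz _.
  rewrite (altform_headZ (altform_contr z fF)) // /contr.
  by case: fF => _ ->; rewrite ?mulr0 //= ?sz // inE eqxx.
apply: vanishes_add => // u /vlineP[k ->] t sz tY; rewrite (altform_headZ fF) //.
rewrite (_ : f _ = 0) ?mulr0 //; apply: (vanishesP _ _ _ h) => // x /tY /orP[] /= xx.
  exact: (subvP (addvSl _ _)).
exact: (subvP (addvSr _ _)).
Qed.

(* P0, P1 and <[w]> + (P1 :&: P0) are members of a pencil of hyperplanes. *)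
Lemma vanishes_pencil l f P0 P1 w : altform l.+1 f ->
  (\dim P0).+1 = m -> (\dim P1).+1 = m -> w \notin P1 ->
  vanishes l.+1 f P1 -> vanishes l.+1 f (<[w]> + (P1 :&: P0))%VS ->
  vanishes l.+1 f P0.
Proof.
move=> fF dP0 dP1 wP1 f1 fw.
have [P01|/subvPn[z zP0 zP1]] := boolP (P0 <= P1)%VS.
  by apply/vanishesP => s sz sP; apply: (vanishesP _ _ _ f1) => // x /sP /(subvP P01).
rewrite (hyperplane_split dP1 zP0 zP1); apply: vanishes_add_line => //.
  apply/vanishesP => s sz sP; apply: (vanishesP _ _ _ f1) => // x /sP.
  by rewrite memv_cap => /andP[].
(* On [P1 :&: P0] the contraction by [z] is the sum of those by [w'] in [<[w]>] and by [p] in [P1];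
   the hypotheses kill both. *)
have : z \in (<[w]> + P1)%VS by rewrite add_line_hyperplane // memvf.
case/memv_addP => w' w'w [p pP ->]; apply/vanishesP => s sz sY.
rewrite /contr (altform_headD fF) //.
rewrite (vanishesP _ _ _ fw) ?(vanishesP _ _ _ f1) ?addr0 //= ?sz //.
  move=> x; rewrite inE => /predU1P[->//|/sY]; by rewrite memv_cap => /andP[].
move=> x; rewrite inE => /predU1P[->|/sY xY]; first exact: (subvP (addvSl _ _)).
exact: (subvP (addvSr _ _)).
Qed.

Lemma card_vspace_leq U (d : nat) : (\dim U <= d)%N ->
  (#|[set x : fV | (x : V) \in U]| <= #|F| ^ d)%N.
Proof.
move=> dU; rewrite card_fvspace leq_exp2l //; exact: finNzRing_gt1.
Qed.

(** Here [q ^ e.+2] stands for the size of [K], and [q ^ e] bounds each of the [q.+1] radicals along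
    a pencil. The inequality is q^2 + q + 1 <= q^3. *)
Lemma card_pencil_bound q e : (1 < q)%N ->
  (q ^ e.+2 + q.+1 * q ^ e <= q ^ e.+3)%N.
Proof.
move=> q1; rewrite !expnS; have : (0 < q ^ e)%N by rewrite expn_gt0; lia.
move: (q ^ e)%N => x x0; have : (q * q + q.+1 <= q * (q * q))%N by nia.
by nia.
Qed.

(** * Vectors with decomposable contraction, compared with a fixed one *)

Section NonDecomposable.

Variables (n : nat) (f : seq V -> F) (v : V).
Hypotheses (fF : altform n.+2 f) (vD : decomposable n.+1 (contr f v)).
Hypothesis vR : v \notin radical n.+2 f fullv.
Let K := radical n.+1 (contr f v) fullv.

Lemma contr_neq0 : ~~ vanishes n.+1 (contr f v) fullv.
Proof. by move: vR; rewrite memv_radical // memvf. Qed.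

Lemma dim_radical_contr_decomposable : (\dim K + n.+1)%N = m.
Proof.
apply: dim_radical_decomposable => //; [exact: altform_contr|exact: contr_neq0].
Qed.

Lemma mem_radical_contr : v \in K.
Proof.
apply/radicalP; first exact: altform_contr.
by move=> s sz; case: fF => _; apply; rewrite /= ?sz // inE eqxx.
Qed.

(** The restriction to [P] has degree [n.+1], while its radical contains [K], of codimension only
    [n] in [P]. *)
Lemma contr_vanishes_hyperplane P : (K <= P)%VS -> (\dim P).+1 = m ->
  vanishes n.+1 (contr f v) P.
Proof.
move=> KP dP; apply/negPn/negP => nv.
have fvF := altform_contr v fF.
have := dim_radical_le fvF nv KP; have := dim_radical_contr_decomposable => dK h.
suff : (\dim K + n.+1 <= \dim P)%N by lia.
by apply: h => u /(radicalP _ fvF) h t sz _; exact: h.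
Qed.

(** Otherwise the radical [R] of f_w is not contained in [P], so [R + P] is everything. The form
    f(w, v, ...) vanishes on [P] because f_v does, and its contractions by [R] are 0; hence it is 0
    and [w] lies in [K]. *)
Lemma vanishes_contr_decomposable P w : w \notin K -> decomposable n.+1 (contr f w) ->
  (K <= P)%VS -> w \in P -> (\dim P).+1 = m -> vanishes n.+1 (contr f w) P.
Proof.
move=> wK dw KP wP dP; apply/negPn/negP => nv.
have fwF := altform_contr w fF; have fvF := altform_contr v fF.
have vP := subvP KP _ mem_radical_contr.
pose R := radical n.+1 (contr f w) fullv.
have dR : (\dim R + n.+1)%N = m.
  apply: dim_radical_decomposable => //; case/nvanishesP: nv => s [sz _ fs].
  by apply/nvanishesP; exists s; split=> // x _; rewrite memvf.
have dPR : (\dim (P :&: R) + n.+1 <= \dim P)%N.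
  apply: (dim_radical_le fwF nv (capvSl _ _)) => u.
  by rewrite memv_cap => /andP[_ /(radicalP _ fwF) h] t sz _; exact: h.
have PR : fullv = (R + P)%VS.
  apply/esym/eqP; rewrite eqEdim subvf /=.
  by have := dimv_sum_cap P R; rewrite addvC; lia.
have sw s : size s = n -> f (w :: v :: s) = - f (v :: w :: s).
  by move=> sz; rewrite (altform_swap fF).
suff h : vanishes n (contr (contr f w) v) fullv.
  case/negP: wK; apply/radicalP => // s sz; rewrite /contr.
  have := vanishesP _ _ _ h s sz (fun x _ => memvf x).
  by rewrite /contr sw // => /eqP; rewrite oppr_eq0 => /eqP.
have hP : vanishes n (contr (contr f w) v) P.
  apply/vanishesP => s sz sP; rewrite /contr sw //.
  rewrite [f _](vanishesP _ _ _ (contr_vanishes_hyperplane KP dP)) ?oppr0 //= ?sz //.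
  by move=> x; rewrite inE => /predU1P[->|/sP].
clear dPR; rewrite /R in PR; clear R dR; case: n fF fwF fvF PR sw hP => [|k] fF' fwF' fvF' PR sw hP.
  apply/vanishesP => s sz _; apply: (vanishesP _ _ _ hP) => //.
  by rewrite (size0nil sz).
rewrite PR; apply: vanishes_add => //; first exact: altform_contr.
move=> u /(radicalP _ fwF') uR t sz _; rewrite /contr.
have := altform_swap fwF' v u sz; rewrite [X in _ = - X]uR ?oppr0 /= ?sz //.
Qed.

Lemma vanishes_hyperplane_transfer P P1 w : (\dim P1).+1 = m -> w \in P -> w \notin P1 ->
  vanishes n.+1 (contr f w) P -> vanishes n.+2 f P1 -> vanishes n.+2 f P.
Proof.
move=> dP1 wP wP1 fw f1; rewrite (hyperplane_split dP1 wP wP1).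
apply: vanishes_add_line => //; apply/vanishesP => s sz sP.
  by apply: (vanishesP _ _ _ f1) => // x /sP; rewrite memv_cap => /andP[].
by apply: (vanishesP _ _ _ fw) => // x /sP; rewrite memv_cap => /andP[].
Qed.

Let D := [set w : fV | decomposable n.+1 (contr f w)].

Lemma vanishes_contr_setD P (w : V) : (w : fV) \in D -> w \notin K -> (K <= P)%VS ->
  w \in P -> (\dim P).+1 = m -> vanishes n.+1 (contr f w) P.
Proof. by rewrite inE => wD wK; exact: vanishes_contr_decomposable. Qed.

(** Each [w] of [D] outside [K] lies on a member of the pencil through [Y], and then in the radical
    of the restriction of [f] to that member, by [vanishes_contr_setD]. *)
Lemma card_decomposable_pencil Y : (K <= Y)%VS -> (\dim Y).+2 = m ->
  (forall P, (Y <= P)%VS -> (\dim P).+1 = m -> ~~ vanishes n.+2 f P) ->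
  exists2 d, (d + n <= m)%N & (#|D| <= #|F| ^ d)%N.
Proof.
move=> KY dY goodY; have dK := dim_radical_contr_decomposable.
have [P' YP' dP'] : exists2 P, (Y <= P)%VS & (\dim P).+1 = m.
  by apply: sub_hyperplane; apply/eqP => YV; clear -dY YV; rewrite YV in dY; lia.
have /subvPn[u' _ u'P'] : ~~ (fullv <= P')%VS.
  by apply/negP => /dimvS; rewrite -dP' ltnn.
have /subvPn[u uP' uY] : ~~ (P' <= Y)%VS.
  apply/negP => /dimvS; have -> : \dim P' = (\dim Y).+1 by apply: succn_inj; rewrite dP'.
  by rewrite ltnn.
have dYx x : x \notin Y -> (\dim (<[x]> + Y)).+1 = m by move=> xY; rewrite dim_add_line.
have P'E : P' = (<[u]> + Y)%VS.
  apply/esym/eqP; rewrite eqEdim subv_add YP' -memvE uP' /=.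
  by rewrite -ltnS dP' dYx.
(* [option F] is the projective line over [F], with [None] at infinity; it indexes the hyperplanes
   through [Y]. *)
pose d (o : option F) : V := if o is Some c then u + c *: u' else u'.
have dY' o : d o \notin Y.
  case: o => [c|] /=; last by apply: contra u'P' => /(subvP YP').
  apply/negP => ucY; have := subvP YP' _ ucY.
  rewrite rpredDl // rpredZeq (negPf u'P') orbF => /eqP c0.
  by rewrite c0 scale0r addr0 (negPf uY) in ucY.
pose P o := (<[d o]> + Y)%VS.
pose R o := radical n.+2 f (P o).
have dR o : (\dim (R o) + n.+3 <= m)%N.
  have gP : ~~ vanishes n.+2 f (P o) by rewrite goodY ?addvSr ?dYx.
  rewrite -(dYx _ (dY' o)) addnS ltnS.
  apply: (dim_radical_le fF gP (radical_sub _ fF)) => w.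
  by rewrite memv_radical // => /andP[_ /vanishesP h] t sz tP; exact: h.
(* So each [R o] has dimension at most [e], [K] has dimension [e.+2], and the exponent sought is
   [m - n = e.+3]. *)
have [e me] : exists e, m = (e + n.+3)%N.
  by exists (m - n.+3)%N; rewrite subnK // (leq_trans _ (dR None)) // leq_addl.
rewrite me in dK; exists e.+3; first by rewrite me; clear; lia.
have DK : D \subset [set x : fV | (x : V) \in K] :|: [set x : fV | [exists o, (x : V) \in R o]].
  apply/subsetP => w wD; rewrite !inE /=; case: (boolP (w \in K)) => //= wK.
  have : w \in (<[u']> + P')%VS by rewrite add_line_hyperplane // memvf.
  case/memv_addP => x /vlineP[b ->] [p]; rewrite P'E.
  case/memv_addP => p' /vlineP[a ->] [y yY] -> wE.
  apply/existsP.
  (* Modulo [Y], [w] is [a *: u + b *: u']; the ratio [b / a] selects its hyperplane. *)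
  have [o wP] : exists o, w \in P o.
    case: (eqVneq a 0) => a0.
      exists None; rewrite wE a0 scale0r add0r; apply: memv_add => //=.
      by rewrite memvZ // memv_line.
    exists (Some (b / a)); rewrite wE addrA; apply: memv_add => //=.
    apply/vlineP; exists a; rewrite scalerDr scalerA mulrCA mulfV // mulr1.
    by rewrite addrC.
  exists o; rewrite memv_radical // wP vanishes_contr_setD ?dYx //.
  exact: subv_trans KY (addvSr _ _).
apply: leq_trans (subset_leq_card DK) _.
apply: leq_trans (_ : #|[set x : fV | (x : V) \in K]| +
    #|[set x : fV | [exists o, (x : V) \in R o]]| <= _)%N.
  by rewrite -cardsUI leq_addr.
apply: leq_trans (card_pencil_bound e (finNzRing_gt1 F)); apply: leq_add.
  by apply: card_vspace_leq; clear -dK; lia.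
apply: leq_trans (_ : \sum_(o : option F) #|[set x : fV | (x : V) \in R o]| <= _)%N.
  rewrite -sum1_card; under [X in (_ <= X)%N]eq_bigr => o _ do rewrite -sum1_card.
  rewrite (exchange_big_dep predT) //= big_mkcond /=; apply: leq_sum => x _.
  rewrite inE; case: existsP => // -[o xo].
  by rewrite (bigD1 o) ?inE //=; case: ifP => _; rewrite ?add1n.
rewrite -[#|F|.+1]card_option -sum_nat_const; apply: leq_sum => o _.
by apply: card_vspace_leq; rewrite -(leq_add2r n.+3) -me.
Qed.

(** The intersection [R] of the hyperplanes through [K] on which [f] vanishes contains [D]. It meets
    [P0] inside [K], so it exceeds [K] by at most one dimension. *)
Lemma card_decomposable_no_pencil P0 : (K <= P0)%VS -> (\dim P0).+1 = m ->
  ~~ vanishes n.+2 f P0 ->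
  (forall Y, (K <= Y)%VS -> (\dim Y).+2 = m ->
    exists P, [/\ (Y <= P)%VS, (\dim P).+1 = m & vanishes n.+2 f P]) ->
  exists2 d, (d + n <= m)%N & (#|D| <= #|F| ^ d)%N.
Proof.
move=> KP0 dP0 good0 badY; have dK := dim_radical_contr_decomposable.
pose bad P := [&& (K <= P)%VS, (\dim P).+1 == m & vanishes n.+2 f P].
pose R := (\bigcap_(P | bad P) P)%VS.
have badP P : (K <= P)%VS -> (\dim P).+1 = m -> vanishes n.+2 f P -> (R <= P)%VS.
  by move=> h1 h2 h3; apply: bigcapv_inf (subvv _); rewrite /bad h1 h2 eqxx.
(* For [x] in [R] and [P0] but not in [K], take [Y] in [P0] avoiding [x]: a hyperplane through [Y]
   on which [f] vanishes contains [x], so it is [P0]. *)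
have RP0 : (R :&: P0 <= K)%VS.
  apply/subvP => x; rewrite memv_cap => /andP[xR xP0]; apply/negPn/negP => xK.
  have [Y [KY YP0 xY dY]] := hyperplane_avoiding KP0 xP0 xK.
  have [|P [YP dP vP]] := badY Y KY; first by rewrite -dP0 -dY.
  have xP := subvP (badP P (subv_trans KY YP) dP vP) _ xR.
  have P0E : P0 = (<[x]> + Y)%VS.
    by apply/esym/eqP; rewrite eqEdim subv_add YP0 -memvE xP0 /= dim_add_line // dY.
  case/negP: (good0); suff -> : P0 = P by [].
  apply/eqP; rewrite eqEdim -(leq_add2r 1) !addn1 dP dP0 leqnn andbT.
  by rewrite P0E subv_add YP -memvE xP.
exists (\dim R).
  move: (dimv_sum_cap R P0) (dimvS RP0) (dimvS (subvf (R + P0)%VS)).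
  move: dK dP0; rewrite -/K; clear; move: (\dim K) (\dim P0) (\dim R) (\dim (R + P0)).
  by move: (\dim (R :&: P0)) m => *; lia.
apply: leq_trans (card_vspace_leq (leqnn _)); apply: subset_leq_card.
suff DR (w : V) : (w : fV) \in D -> w \in R by apply/subsetP => w wD; rewrite inE DR.
move=> wD; apply/negPn/negP => wR.
have wK : w \notin K.
  apply: contra wR => wK; rewrite memvE; apply/subv_bigcapP => P /and3P[KP _ _].
  by rewrite -memvE (subvP KP).
have [P1 [KP1 dP1 v1 wP1]] : exists P1, [/\ (K <= P1)%VS, (\dim P1).+1 = m,
    vanishes n.+2 f P1 & w \notin P1].
  have [/existsP[P1 /andP[/and3P[? /eqP ? ?] ?]]|/existsPn h] :=
    boolP [exists P : {vspace V}, bad P && (w \notin P)]; first by exists P1.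
  case/negP: wR; rewrite memvE; apply/subv_bigcapP => P bP.
  by have := h P; rewrite bP /= negbK memvE.
(* Vanishing passes from [P1] to the span of [w] and [P1 :&: P0]. This is [P0] itself if [w] lies in
   [P0]; otherwise [vanishes_pencil] carries it on to [P0]. *)
case: (boolP (w \in P0)) => wP0.
  case/negP: (good0); apply: (vanishes_hyperplane_transfer dP1 wP0 wP1) => //.
  exact: vanishes_contr_setD.
case/negP: (good0); apply: (vanishes_pencil fF dP0 dP1 wP1 v1).
have wP : w \in (<[w]> + (P1 :&: P0))%VS by rewrite memvE addvSl.
apply: (vanishes_hyperplane_transfer dP1 wP wP1) => //; apply: vanishes_contr_setD => //.
  by rewrite (subv_trans _ (addvSr _ _)) // subv_cap KP1.
have [P01|/subvPn[z zP0 zP1]] := boolP (P0 <= P1)%VS.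
  case/negP: (good0); apply/vanishesP => s sz sP; apply: (vanishesP _ _ _ v1) => // x /sP.
  exact: (subvP P01).
rewrite dim_add_line ?memv_cap ?(negPf wP1) // -dP0; congr _.+1.
by rewrite [P0 in RHS](hyperplane_split dP1 zP0 zP1) dim_add_line // memv_cap (negPf zP1).
Qed.

End NonDecomposable.

(** The bound q^(m-n), multiplied out to avoid truncated subtraction. In degree 2 it says nothing;
    in higher degree it also forces some contraction to be nondecomposable. *)
Lemma card_decomposable n f : altform n.+2 f -> ~~ decomposable n.+2 f ->
  (#|[set w : fV | decomposable n.+1 (contr f w)]| * #|F| ^ n <= #|F| ^ m)%N.
Proof.
move=> fF nd; pose D := [set w : fV | decomposable n.+1 (contr f w)]; rewrite -/D.
suff [d dm Dd] : exists2 d, (d + n <= m)%N & (#|D| <= #|F| ^ d)%N.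
  rewrite (leq_trans (leq_mul Dd (leqnn _))) // -expnD leq_exp2l //.
  exact: finNzRing_gt1.
have [DR|/subsetPn[v]] := boolP (D \subset [set x : fV | (x : V) \in radical n.+2 f fullv]).
  exists (\dim (radical n.+2 f fullv)).
    apply: leq_trans (dim_radical_fullv fF (nondecomposable_neq0 fF nd)).
    by rewrite leq_add2l -addn2 leq_addr.
  by apply: leq_trans (subset_leq_card DR) _; apply: card_vspace_leq.
rewrite !inE => vD vR; pose K := radical n.+1 (contr f v) fullv.
have dK : (\dim K + n.+1)%N = m := dim_radical_contr_decomposable fF vD vR.
(* If [f] vanished on every hyperplane through [K], its radical would have codimension at most
   [n.+2] and [f] would be decomposable. *)
have [P0 [KP0 dP0 good0]] : exists P0,
    [/\ (K <= P0)%VS, (\dim P0).+1 = m & ~~ vanishes n.+2 f P0].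
  have [/existsP[P0 /and3P[k /eqP d g]]|/existsPn h] :=
    boolP [exists P : {vspace V}, [&& (K <= P)%VS, (\dim P).+1 == m & ~~ vanishes n.+2 f P]].
    by exists P0.
  case/negP: nd; rewrite /decomposable -dK -[n.+2]add1n addnA leq_add2r addn1.
  apply: (dim_radical_hyperplanes fF dK) => P kP dP.
  by have := h P; rewrite kP dP eqxx /= => /negPn.
have [/existsP[Y /and3P[KY /eqP dY /forallP goodY]]|/existsPn nY] :=
  boolP [exists Y : {vspace V}, [&& (K <= Y)%VS, (\dim Y).+2 == m &
    [forall P : {vspace V}, (Y <= P)%VS && ((\dim P).+1 == m) ==> ~~ vanishes n.+2 f P]]].
  apply: (card_decomposable_pencil fF vD vR KY dY) => P YP dP.
  by apply: (implyP (goodY P)); rewrite YP dP eqxx.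
apply: (card_decomposable_no_pencil fF vD vR KP0 dP0 good0) => Y KY dY.
have := nY Y; rewrite KY dY eqxx /= => /forallPn[P].
by rewrite negb_imply negbK => /andP[/andP[YP /eqP dP] vP]; exists P.
Qed.

End Decomposable.

(** * Weights of forms *)

Section Weight.

Variables (F : finFieldType) (V : vectType F).
Local Notation fV := (finvect_type V).
Local Notation m := (\dim {:V}).
Local Notation q := #|F|.
Implicit Types (f g : seq V -> F) (U P K Y : {vspace V}) (s t : seq V).

(* Tuples rather than subspaces are counted: each L with f|_L <> 0 accounts for
   |GL_l(q)| of them, see [weightE]. *)
Definition weight (l : nat) f := #|[set t : l.-tuple fV | f t != 0]|.

(** The weight of a nonzero decomposable form: the factor of index [i] counts the vectors outside a
    radical of codimension [i.+1]. *)
Definition min_weight (l : nat) := (\prod_(i < l) (q ^ m - q ^ (m - i.+1)))%N.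

Lemma min_weightS l : min_weight l.+1 = (min_weight l * (q ^ m - q ^ (m - l.+1)))%N.
Proof. by rewrite /min_weight big_ord_recr. Qed.

Lemma weight0 f : weight 0 f = (f [::] != 0).
Proof.
rewrite /weight; case f0: (f [::] == 0).
  by apply/eqP; rewrite cards_eq0 -subset0; apply/subsetP => t; rewrite inE tuple0 f0.
rewrite (_ : [set _ | _] = [set: 0.-tuple fV]) ?cardsT ?card_tuple ?expn0 //.
by apply/setP => t; rewrite !inE tuple0 /= f0.
Qed.

Lemma weightS l f : weight l.+1 f = (\sum_(v : fV) weight l (contr f v))%N.
Proof.
rewrite /weight -sum1dep_card (reindex (fun p : fV * l.-tuple fV => [tuple of p.1 :: p.2])) /=.
  rewrite -(pair_big_dep xpredT (fun v (t : l.-tuple fV) => f (v :: t) != 0)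
              (fun _ _ => 1%N)) /=.
  by apply: eq_bigr => v _; rewrite sum1dep_card.
exists (fun t : l.+1.-tuple fV => (thead t, [tuple of behead t])) => [[v t]|t] _ /=.
  by congr (_, _); apply: val_inj.
by rewrite [in RHS](tuple_eta t); apply: val_inj.
Qed.

Lemma weight_vanishes l f : vanishes l f fullv -> weight l f = 0%N.
Proof.
move=> /vanishesP f0; apply/eqP; rewrite cards_eq0 -subset0; apply/subsetP => t.
by rewrite inE f0 ?eqxx ?size_tuple // => x _; rewrite memvf.
Qed.

Lemma sum_notin_set (A : {set fV}) (c : nat) :
  (\sum_(v : fV) (v \notin A) * c + #|A| * c = q ^ m * c)%N.
Proof.
rewrite -big_distrl -mulnDl; congr (_ * _)%N.
rewrite -(card_fvspace (fullv : {vspace V})).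
have -> : [set x : fV | (x : V) \in fullv] = [set: fV] by apply/setP => x; rewrite !inE memvf.
rewrite cardsT -(cardsC A) addnC; congr addn.
rewrite -sum1_card [RHS]big_mkcond; apply: eq_bigr => v _.
by rewrite inE; case: (v \in A).
Qed.

Lemma sum_notin U (c : nat) :
  (\sum_(v : fV) ((v : V) \notin U) * c + q ^ \dim U * c = q ^ m * c)%N.
Proof.
rewrite -(card_fvspace U) -(sum_notin_set [set x : fV | (x : V) \in U]).
by congr addn; apply: eq_bigr => v _; rewrite inE.
Qed.

Lemma dim_radical_contr l f v : altform l.+2 f -> v \notin radical l.+2 f fullv ->
  (\dim (radical l.+2 f fullv) < \dim (radical l.+1 (contr f v) fullv))%N.
Proof.
move=> fF vR; rewrite -(dim_add_line vR); apply: dimvS; rewrite subv_add.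
have fvF := altform_contr v fF.
rewrite -memvE (mem_radical_contr v fF); apply/subvP => u /(radicalP _ fF) uR.
apply/radicalP => // s sz; rewrite /contr (altform_swap fF) // uR ?oppr0 //= sz //.
Qed.

Lemma notin_radical l f v : altform l.+1 f ->
  (v \notin radical l.+1 f fullv) = ~~ vanishes l (contr f v) fullv.
Proof. by move=> fF; rewrite memv_radical // memvf. Qed.

(** The contraction is nonzero exactly for [v] outside the radical, whose codimension is at least
    the degree. *)
Lemma weight_ge l f : altform l f -> ~~ vanishes l f fullv -> (min_weight l <= weight l f)%N.
Proof.
elim: l f => [|l IH] f fF nv.
  case/nvanishesP: nv => s [sz _]; rewrite (size0nil sz) /min_weight big_ord0 weight0.
  by move=> ->.
have dR := dim_radical_fullv fF nv; pose R := radical l.+1 f fullv.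
rewrite weightS min_weightS.
apply: (@leq_trans (\sum_(v : fV) ((v : V) \notin R) * min_weight l)%N).
  have := sum_notin R (min_weight l); set S := (\sum_(v : _) _)%N => eqS.
  have : (q ^ \dim R <= q ^ (m - l.+1))%N.
    by rewrite leq_exp2l ?finNzRing_gt1 // /R; lia.
  move: (min_weight l) (q ^ m)%N (q ^ (m - l.+1))%N (q ^ \dim R)%N eqS => a M x y; nia.
apply: leq_sum => v _; case: (boolP (_ \in R)) => //= vR; rewrite mul1n.
by apply: IH; [exact: altform_contr|rewrite -notin_radical].
Qed.

(** Contractions by vectors outside the radical are again decomposable. Degree 0 is exempted because
    [radical] is meaningful in positive degree only. *)
Lemma weight_decomposable l f : altform l f -> ~~ vanishes l f fullv ->
  ((0 < l)%N -> decomposable l f) -> weight l f = min_weight l.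
Proof.
elim: l f => [|l IH] f fF nv df.
  case/nvanishesP: nv => s [sz _]; rewrite (size0nil sz) /min_weight big_ord0 weight0.
  by move=> ->.
pose R := radical l.+1 f fullv.
have dR : (\dim R + l.+1)%N = m := dim_radical_decomposable fF nv (df isT).
rewrite weightS min_weightS.
transitivity (\sum_(v : fV) ((v : V) \notin R) * min_weight l)%N.
  apply: eq_bigr => v _; case: (boolP (_ \in R)) => vR /=.
    rewrite weight_vanishes ?mul0n //.
    by move: vR; rewrite memv_radical // memvf.
  rewrite mul1n; apply: IH; [exact: altform_contr|by rewrite -notin_radical|].
  case: l fF nv {df} @R dR vR => // l fF nv R dR vR _.
  rewrite /decomposable; have := dim_radical_contr fF vR.
  by move: dR; rewrite /R; lia.
have := sum_notin R (min_weight l); have -> : (m - l.+1)%N = \dim R by lia.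
rewrite mulnBr ![(min_weight l * _)%N]mulnC; lia.
Qed.

Lemma decomposable1 f : altform 1 f -> decomposable 1 f.
Proof.
(* Taken with [K = fullv] and [k = 0]: no hyperplane contains [K]. *)
move=> fF; rewrite /decomposable addn1; apply: dim_radical_hyperplanes => //.
  by rewrite addn0.
by move=> P /dimvS le1 dP; lia.
Qed.

(** Degree 2 is done by hand. In higher degree [card_decomposable] yields a nondecomposable
    contraction; its radical is strictly larger than that of [f], and the induction hypothesis
    applies to it. *)
Lemma dim_radical_nondecomposable l f : altform l.+1 f -> ~~ decomposable l.+1 f ->
  (\dim (radical l.+1 f fullv) + l.+3 <= m)%N.
Proof.
elim: l f => [|l IH] f fF nd.
  by rewrite decomposable1 in nd.
case: l IH fF nd => [|l] IH fF nd.
  have /nvanishesP[s [sz _ fs]] := nondecomposable_neq0 fF nd.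
  case: s sz fs => [|x [|y [|]]] // _ fxy.
  have f1 z : altform 1 (contr f z) by apply: altform_contr.
  have fzz z : f [:: z; z] = 0 by case: fF => _ -> //=; rewrite inE eqxx.
  have memH z w : (w \in radical 1 (contr f z) fullv) = (f [:: z; w] == 0).
    apply/radicalP/eqP => // [h|h s /size0nil->] //; exact: h.
  have dH z w : f [:: z; w] != 0 -> (\dim (radical 1 (contr f z) fullv)).+1 = m.
    move=> fzw; apply/eqP; rewrite eqn_leq -addn1.
    rewrite (dim_radical_le_support (f1 z) (erefl : size [:: w] = 1%N) fzw) /=.
    rewrite addn1; apply: dim_radical_hyperplanes => //; first by rewrite addn0.
    by move=> P /dimvS le1 dP; lia.
  have fyx : f [:: y; x] != 0 by rewrite (altform_swap fF) // oppr_eq0.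
  (* [U] below is the orthogonal of the plane of [x] and [y], and contains the radical. If [f]
     vanishes on [U], then [f] is decomposable; if not, the radical has codimension at least 2 in
     [U]. *)
  pose Hx := radical 1 (contr f x) fullv; pose Hy := radical 1 (contr f y) fullv.
  have xHx : x \in Hx by rewrite memH fzz.
  have xHy : x \notin Hy by rewrite memH.
  have yHx : y \notin Hx by rewrite memH.
  have HxE := hyperplane_split (dH _ _ fyx) xHx xHy; rewrite -/Hy in HxE.
  pose U := (Hy :&: Hx)%VS.
  have dU : (\dim U).+2 = m.
    rewrite -(dH _ _ fxy) -/Hx HxE dim_add_line // memv_cap (negPf xHy) //.
  have memU u : u \in U -> f [:: y; u] = 0 /\ f [:: x; u] = 0.
    by rewrite memv_cap !memH => /andP[/eqP-> /eqP->].
  have [v1|nv] := boolP (vanishes 2 f U).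
    case/negP: nd; rewrite /decomposable addn2 -dU !ltnS; apply: dimvS.
    apply/subvP => u uU; rewrite memv_radical // memvf /=.
    have [yu xu] := memU u uU.
    rewrite -(add_line_hyperplane (dH _ _ fxy) yHx) -/Hx HxE.
    have h z : f [:: z; u] = 0 -> vanishes 0 (contr (contr f u) z) U.
      move=> zu; apply/vanishesP => s /size0nil -> _.
      by rewrite /contr (altform_swap fF) // zu oppr0.
    have fuU : vanishes 1 (contr f u) (<[x]> + U)%VS.
      apply: vanishes_add_line => //; last exact: h.
      apply/vanishesP => s sz sU; apply: (vanishesP _ _ _ v1) => /=; first by rewrite sz.
      by move=> z; rewrite inE => /predU1P[->|/sU].
    apply: vanishes_add_line => //.
    apply/vanishesP => s /size0nil -> _; by rewrite /contr (altform_swap fF) // yu oppr0.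
  have RU : (radical 2 f fullv <= U)%VS.
    by apply/subvP => u /(radicalP _ fF) uR;
      rewrite memv_cap !memH !(altform_swap fF _ u) // !uR // oppr0 eqxx.
  have := dim_radical_le fF nv RU => h.
  suff : (\dim (radical 2 f fullv) + 2 <= \dim U)%N by lia.
  by apply: h => u /(radicalP _ fF) uR t sz _; exact: uR.
have : exists v, ~~ decomposable l.+2 (contr f v).
  have [/existsP[v dv]|/existsPn h] := boolP [exists v : fV, ~~ decomposable l.+2 (contr f v)].
    by exists v.
  have := card_decomposable fF nd.
  rewrite (_ : [set _ | _] = [set x : fV | (x : V) \in fullv]); last first.
    by apply/setP => v; rewrite !inE memvf; have := h v; rewrite negbK.
  rewrite card_fvspace -expnD leq_exp2l ?finNzRing_gt1 //; lia.
case=> v nv; have fvF := altform_contr v fF; have := IH _ fvF nv.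
have vR : v \notin radical l.+3 f fullv by rewrite notin_radical // nondecomposable_neq0.
have := dim_radical_contr fF vR; lia.
Qed.

(* x = q, M = q^m and r = q^(m-l-4): equality in the induction step. *)
Lemma min_weight_identity (M r x : nat) : (r * x ^ 4 <= M)%N ->
  ((x ^ 2 + 1) * (M - r * x ^ 2) + x ^ 2 * r + r * x ^ 4 = x ^ 2 * M + M)%N.
Proof.
have -> : (x ^ 4 = x ^ 2 * x ^ 2)%N by rewrite -expnD.
move: (x ^ 2)%N => y h; have h2 : (r * y <= M)%N.
  by apply: leq_trans h; case: y => [|y]; rewrite ?muln0 // leq_mul2l leq_pmulr ?orbT.
have [d ->] : exists d, M = (r * y + d)%N by exists (M - r * y)%N; rewrite subnKC.
by rewrite addKn !mulnDl !mulnDr mul1n; nia.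
Qed.

(** Takes r = q^(m-n-4) as a unit: the powers compared become multiples of [r], and exponents with
    subtraction disappear. *)
Lemma dim_ambient_split n : (n.+4 <= m)%N -> exists2 r, (q ^ m = r * q ^ 4 * q ^ n)%N &
  (forall d, d + n.+4 <= m -> q ^ d <= r)%N /\ (forall d, m <= d + n.+4 -> r <= q ^ d)%N
  /\ (q ^ (m - n.+2) = r * q ^ 2)%N.
Proof.
move=> nm; have q1 := finNzRing_gt1 F; exists (q ^ (m - n.+4))%N.
  by rewrite -!expnD; congr (_ ^ _)%N; lia.
split=> [d dn|]; first by rewrite leq_exp2l //; lia.
split=> [d dn|]; first by rewrite leq_exp2l //; lia.
by rewrite -expnD; congr (_ ^ _)%N; lia.
Qed.

(** The ratio to the minimum is at least 1 + q^(-2). By induction this holds for the nondecomposable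
    contractions; the other nonzero ones reach at least the minimum, and [card_decomposable] bounds
    their number. *)
Lemma weight_nondecomposable_ge l f : altform l.+1 f -> ~~ decomposable l.+1 f ->
  ((q ^ 2 + 1) * min_weight l.+1 <= q ^ 2 * weight l.+1 f)%N.
Proof.
elim: l f => [|l IH] f fF nd.
  by rewrite decomposable1 in nd.
have dR := dim_radical_nondecomposable fF nd; pose R := radical l.+2 f fullv.
have q1 := finNzRing_gt1 F.
have [r Mr [rR [_ r2]]] := dim_ambient_split (leq_trans (leq_addl _ _) dR).
pose D := [set v : fV | decomposable l.+1 (contr f v)].
have cD : (#|D| <= r * q ^ 4)%N.
  have := card_decomposable fF nd; by rewrite -/D Mr leq_pmul2r // expn_gt0 (ltnW q1).
pose a := min_weight l.+1; have cR : (q ^ \dim R <= r)%N by apply: rR.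
have sD := sum_notin_set D a.
have : (\sum_(v : fV) ((v : V) \notin R) * (q ^ 2 * a) + \sum_(v : fV) (v \notin D) * a
         <= q ^ 2 * weight l.+2 f)%N.
  rewrite weightS big_distrr -big_split /=; apply: leq_sum => v _.
  have fvF := altform_contr v fF.
  have [vR|vR] := boolP ((v : V) \in R).
    suff -> : v \in D by rewrite !mul0n.
    rewrite inE; apply: contraLR vR => nv.
    by rewrite notin_radical // nondecomposable_neq0.
  rewrite mul1n; have [vD|] := boolP (v \in D).
    by rewrite mul0n addn0 leq_mul2l weight_ge ?orbT // -notin_radical.
  rewrite inE => vD; rewrite mul1n -{2}[a]mul1n -mulnDl; exact: IH.
have := sum_notin R (q ^ 2 * a).
rewrite min_weightS -/a r2.
have := @min_weight_identity (q ^ m) r q; rewrite {1}Mr leq_pmulr ?expn_gt0 ?(ltnW q1) //.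
move=> /(_ isT) eqM.
move: (\sum_(v : fV) (_ \notin R) * _)%N (\sum_(v : fV) (v \notin D) * a)%N sD => S1 S2.
move: (q ^ \dim R)%N cR #|D| cD (weight l.+2 f) eqM.
move: (q ^ m)%N (q ^ 4)%N (q ^ 2)%N => M x4 x2 y yr d dr w eqM sD sR le.
have h1 : (d * a <= r * x4 * a)%N by rewrite leq_mul2r dr orbT.
have h2 : (y * (x2 * a) <= r * (x2 * a))%N by rewrite leq_mul2r yr orbT.
have : ((x2 + 1) * (a * (M - r * x2)) + x2 * r * a + r * x4 * a = x2 * M * a + M * a)%N.
  by rewrite -[in RHS]mulnDl -eqM; clear; nia.
move: sD sR le h1 h2; clear; lia.
Qed.

(** The same count from above: contractions by the q^(m-l) vectors of [R] are decomposable by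
    [dim_radical_hyperplanes], and the radical of [f] has codimension at most l + 4. *)
Lemma weight_le_step l f R : altform l.+2 f -> (\dim R + l)%N = m -> (l.+4 <= m)%N ->
  (m <= \dim (radical l.+2 f fullv) + l.+4)%N ->
  (forall P, (R <= P)%VS -> (\dim P).+1 = m -> vanishes l.+2 f P) ->
  (forall v, v \notin R ->
    q ^ 2 * weight l.+1 (contr f v) <= (q ^ 2 + 1) * min_weight l.+1)%N ->
  (q ^ 2 * weight l.+2 f <= (q ^ 2 + 1) * min_weight l.+2)%N.
Proof.
move=> fF dR lm dr fR IH; have q1 := finNzRing_gt1 F.
pose N := radical l.+2 f fullv.
have [r Mr [_ [rN r2]]] := dim_ambient_split lm; have cN := rN _ dr; rewrite -/N in cN.
have cR : (q ^ \dim R)%N = (r * q ^ 4)%N.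
  by apply/eqP; rewrite -(@eqn_pmul2r (q ^ l)) ?expn_gt0 ?(ltnW q1) // -Mr -expnD dR.
pose a := min_weight l.+1.
have : (q ^ 2 * weight l.+2 f <=
        \sum_(v : fV) ((v : V) \notin N) * (q ^ 2 * a) + \sum_(v : fV) ((v : V) \notin R) * a)%N.
  rewrite weightS big_distrr -big_split /=; apply: leq_sum => v _.
  have fvF := altform_contr v fF.
  have [vN|vN] := boolP ((v : V) \in N).
    rewrite weight_vanishes ?muln0 //.
    by apply/negPn; rewrite -notin_radical // vN.
  rewrite mul1n; have [vR|vR] := boolP ((v : V) \in R); last first.
    by rewrite mul1n -{2}[a]mul1n -mulnDl; exact: IH.
  rewrite mul0n addn0 weight_decomposable // -?notin_radical // => _.
  have h := @dim_radical_hyperplanes F V l (contr f v) R fvF dR.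
  rewrite /decomposable -[X in (X <= _)%N]dR.
  rewrite -[l.+1]add1n addnA leq_add2r addn1; apply: h => P RP dP.
  apply/vanishesP => s sz sP; rewrite /contr.
  apply: (vanishesP _ _ _ (fR P RP dP)) => /=; first by rewrite sz.
  by move=> x; rewrite inE => /predU1P[->|/sP //]; apply: (subvP RP).
have := sum_notin N (q ^ 2 * a); have := sum_notin R a.
rewrite min_weightS -/a r2 cR.
have := @min_weight_identity (q ^ m) r q; rewrite {1}Mr leq_pmulr ?expn_gt0 ?(ltnW q1) //.
move=> /(_ isT) eqM.
move: (\sum_(v : fV) (_ \notin N) * _)%N (\sum_(v : fV) (_ \notin R) * a)%N => S1 S2.
move: (q ^ \dim N)%N cN (weight l.+2 f) eqM.
move: (q ^ m)%N (q ^ 4)%N (q ^ 2)%N => M x4 x2 y yr w eqM sD sR le.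
have h2 : (r * (x2 * a) <= y * (x2 * a))%N by rewrite leq_mul2r yr orbT.
have : ((x2 + 1) * (a * (M - r * x2)) + x2 * r * a + r * x4 * a = x2 * M * a + M * a)%N.
  by rewrite -[in RHS]mulnDl -eqM; clear; nia.
move: sD sR le h2; clear; lia.
Qed.

(* The forms of the shape xi_1 /\ ... /\ xi_l /\ eta, where R is the common kernel of
   the xi_i and eta is a 2-form of rank 4 on R. *)
Lemma weight_le l f R : altform l.+2 f -> (\dim R + l)%N = m -> (l.+4 <= m)%N ->
  (m <= \dim (radical l.+2 f fullv) + l.+4)%N ->
  (forall P, (R <= P)%VS -> (\dim P).+1 = m -> vanishes l.+2 f P) ->
  (q ^ 2 * weight l.+2 f <= (q ^ 2 + 1) * min_weight l.+2)%N.
Proof.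
have q1 := finNzRing_gt1 F.
elim: l f R => [|l IH] f R fF dR lm dr fR.
  (* For [l = 0], [R] is the whole space and there is no [v] outside it. *)
  pose n := 0%N; have IH : forall v, v \notin R ->
      (q ^ 2 * weight n.+1 (contr f v) <= (q ^ 2 + 1) * min_weight n.+1)%N.
    move=> v; suff -> : R = fullv by rewrite memvf.
    by apply/eqP; rewrite eqEdim subvf -dR addn0 leqnn.
  exact: (weight_le_step fF dR lm dr fR IH).
apply: (weight_le_step fF dR lm dr fR) => v vR; have fvF := altform_contr v fF.
have [vr|vr] := boolP (v \in radical l.+3 f fullv).
  by rewrite weight_vanishes ?muln0 //; apply/negPn; rewrite -notin_radical // vr.
(* The contraction has the same shape, with [<[v]> + R], of codimension one less, in the role of
   [R]. *)
apply: (IH _ (<[v]> + R)%VS) => //.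
- by rewrite dim_add_line // addSnnS.
- exact: leq_trans lm.
- have := dim_radical_contr fF vr; move: dr; clear; lia.
move=> P; rewrite subv_add -memvE => /andP[vP RP] dP.
apply/vanishesP => s sz sP; rewrite /contr.
  apply: (vanishesP _ _ _ (fR P RP dP)) => /=; first by rewrite sz.
by move=> x; rewrite inE => /predU1P[->|/sP].
Qed.

End Weight.

(** * Counting subspaces *)

Section Counting.

Variables (F : finFieldType) (V : vectType F).
Local Notation fV := (finvect_type V).
Local Notation m := (\dim {:V}).
Local Notation q := #|F|.
Implicit Types (f g : seq V -> F) (L U P K Y : {vspace V}) (s t : seq V).

(** The number of free [k]-tuples in dimension [d]; for [d = k], the order of GL_k(q). *)
Definition nbases (k d : nat) := (\prod_(i < k) (q ^ d - q ^ i))%N.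

Lemma nbases_gt0 k d : (k <= d)%N -> (0 < nbases k d)%N.
Proof.
move=> kd; rewrite /nbases; apply: prodn_gt0 => i.
by rewrite subn_gt0 ltn_exp2l ?finNzRing_gt1 // (leq_trans (ltn_ord i)).
Qed.

Lemma card_free_tuples k L :
  #|[set t : k.-tuple fV | free (t : seq V) && (<<(t : seq V)>> <= L)%VS]| = nbases k (\dim L).
Proof.
elim: k => [|k IH].
  rewrite /nbases big_ord0 (_ : [set _ | _] = [set: 0.-tuple fV]) ?cardsT ?card_tuple //.
  by apply/setP => t; rewrite !inE tuple0 /= nil_free span_nil sub0v.
rewrite /nbases big_ord_recr -/(nbases k (\dim L)) -IH /=.
rewrite -sum1dep_card (reindex (fun p : k.-tuple fV * fV => [tuple of p.2 :: p.1])) /=; last first.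
  exists (fun t : k.+1.-tuple fV => ([tuple of behead t], thead t)) => [[t v]|t] _ /=.
    by congr (_, _); apply: val_inj.
  by rewrite [in RHS](tuple_eta t); apply: val_inj.
transitivity (\sum_(t : k.-tuple fV | free (t : seq V) && (<<(t : seq V)>> <= L)%VS)
   \sum_(v : fV | ((v : V) \in L) && ((v : V) \notin <<(t : seq V)>>%VS)) 1)%N.
  rewrite pair_big_dep /=; apply: eq_bigl => -[t v] /=.
  rewrite free_cons span_cons subv_add -memvE.
  by case: (_ \in L); rewrite ?andbF //= [RHS]andbC andbA.
rewrite -sum1dep_card big_distrl /=; apply: eq_bigr => t /andP[ft tL].
rewrite mul1n sum1dep_card -!(card_fvspace L).
have -> : (q ^ k = #|[set v : fV | (v : V) \in <<(t : seq V)>>%VS]|)%N.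
  by rewrite card_fvspace (eqP ft) size_tuple.
have tL' : [set v : fV | (v : V) \in <<(t : seq V)>>%VS] \subset [set v : fV | (v : V) \in L].
  by apply/subsetP => v; rewrite !inE; apply: (subvP tL).
rewrite -(cardsDS tL'); apply: eq_card => v; rewrite !inE andbC //.
Qed.

Lemma card_tuples_spanning k (X : {set {vspace V}}) : (forall L, L \in X -> \dim L = k) ->
  #|[set t : k.-tuple fV | free (t : seq V) && (<<(t : seq V)>>%VS \in X)]|
   = (#|X| * nbases k k)%N.
Proof.
move=> Xk; rewrite -sum1dep_card.
rewrite (partition_big (fun t : k.-tuple fV => <<(t : seq V)>>%VS) (mem X)) /=; last first.
  by move=> t /andP[].
rewrite -sum_nat_const; apply: eq_bigr => L LX.
rewrite -[in RHS](Xk L LX) -[in RHS]card_free_tuples sum1dep_card (Xk L LX).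
apply: eq_card => t; rewrite !inE; case: (boolP (free (t : seq V))) => //= ft.
rewrite eqEdim (eqP ft) size_tuple (Xk L LX) leqnn andbT.
apply: andb_idl => tL; suff -> : <<(t : seq V)>>%VS = L by [].
by apply/eqP; rewrite eqEdim tL (eqP ft) size_tuple Xk /=.
Qed.

Lemma card_grassmannian k :
  (#|[set L : {vspace V} | \dim L == k]| * nbases k k)%N = nbases k m.
Proof.
rewrite -card_tuples_spanning => [|L]; last by rewrite inE => /eqP.
rewrite -card_free_tuples; apply: eq_card => t; rewrite !inE subvf andbT.
by apply: andb_idr => ft; rewrite (eqP ft) size_tuple.
Qed.

Lemma altform_free l f s : altform l f -> size s = l -> f s != 0 -> free s.
Proof.
move=> fF sz fs; rewrite /free eqn_leq dim_span /=.
case: l fF sz => [|l] fF sz; first by rewrite sz.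
rewrite sz; suff : (\dim (0%VS : {vspace V}) + l.+1 <= \dim <<s>>)%N by rewrite dimv0.
apply: (dim_radical_le fF).
- by apply/nvanishesP; exists s; split=> // x; apply: memv_span.
- exact: sub0v.
by move=> u; rewrite memv0 => /eqP -> t szt _; rewrite (altform_head0 fF).
Qed.

Definition nonvanishing_spaces l f := [set L : {vspace V} | (\dim L == l) && ~~ vanishes l f L].

(** By [altform_free] and [vanishes_span], the tuples on which [f] is nonzero are precisely the
    bases of the counted subspaces. *)
Lemma weightE l f : altform l f -> weight l f = (#|nonvanishing_spaces l f| * nbases l l)%N.
Proof.
move=> fF; rewrite -card_tuples_spanning => [|L]; last by rewrite inE => /andP[/eqP].
apply: eq_card => t; rewrite !inE; apply/idP/and3P => [ft|[ft _ /nvanishesP[s [sz st fs]]]].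
  have tfree := altform_free fF (size_tuple t) ft.
  split=> //; first by rewrite (eqP tfree) size_tuple.
  by apply/nvanishesP; exists t; rewrite size_tuple; split=> // x; apply: memv_span.
apply: contraNneq fs => ft0; apply/eqP.
by apply: (vanishesP _ _ _ (vanishes_span fF (size_tuple t) ft0)).
Qed.

Lemma min_weightE l : (l <= m)%N -> min_weight V l = (q ^ (l * (m - l)) * nbases l l)%N.
Proof.
move=> lm; rewrite /min_weight /nbases [(l * _)%N]mulnC expnM.
have -> : ((q ^ (m - l)) ^ l = \prod_(i < l) q ^ (m - l))%N by rewrite prod_nat_const card_ord.
(* Reversed, the factor of index [i] is q^m - q^(m-l+i) = q^(m-l) (q^l - q^i). *)
rewrite [LHS](reindex_inj rev_ord_inj) -big_split /=; apply: eq_bigr => i _.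
by rewrite /= mulnBr -!expnD subnK // subnSK // subnBA ?addnBAC // ltnW.
Qed.

End Counting.

(** * Alternating maps as forms on sequences, and dual forms *)

Section ExteriorForms.

Variables (F : finFieldType) (V : vectType F) (l : nat).
Implicit Types (h : {ffun 'I_l -> V} -> F^o) (s X e : seq V).

(** The default of nth is reached only on sequences shorter than [l], where [altform] asks
    nothing. *)
Definition seq_form h : seq V -> F := fun s => h [ffun i : 'I_l => s`_i].

Lemma seq_form_altform h : multilinear h -> alternating h -> altform l (seq_form h).
Proof.
move=> hM hA; split=> [s1 s2 a x y sz|s sz /(uniqPn 0)[i [j [ij js nij]]]].
  have il : (size s1 < l)%N by rewrite -sz ltnS leq_addr.
  pose w := [ffun i : 'I_l => (s1 ++ 0 :: s2)`_i].
  have upd z : [ffun i : 'I_l => (s1 ++ z :: s2)`_i] = update w (Ordinal il) z.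
    apply/ffunP => i; rewrite !ffunE -val_eqE /= !nth_cat.
    by case: ltngtP => // [ | ->]; rewrite ?subnn // => lt; rewrite -[(i - _)%N]prednK ?subn_gt0.
  by rewrite /seq_form !upd hM.
have jl : (j < l)%N by rewrite -sz.
have il : (i < l)%N := ltn_trans ij jl.
apply: (hA _ (Ordinal il) (Ordinal jl)); first by rewrite -val_eqE /= ltn_eqF.
by rewrite !ffunE.
Qed.

(** The wedge product of the coordinate functionals dual to [e] within [X], realised as a
    determinant of coordinates. *)
Lemma dual_form X e : free X -> uniq e -> size e = l -> {subset e <= X} ->
  exists h, [/\ multilinear h, alternating h, seq_form h e = 1
    & forall x, x \in X -> x \notin e -> forall s, size s = l -> x \in s -> seq_form h s = 0].
Proof.
move=> fX ue sze eX.
(* A member of [X] outside [e] has index [l] in [e], hence a zero row. *)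
pose d (x : V) : 'rV[F]_l := \row_j (index x e == j)%:R.
have [T /(_ fX)] := linear_of_free X [seq d x | x <- X].
rewrite size_map => /(_ erefl) /eq_in_map TE.
pose M (w : {ffun 'I_l -> V}) := \matrix_(i, j) T (w i) 0 j.
have rowM w i : row i (M w) = T (w i) by apply/rowP => j; rewrite !mxE.
have row'M w i x : row' i (M (update w i x)) = row' i (M w).
  by apply/matrixP => k j; rewrite !mxE ffunE eq_sym (negPf (neq_lift _ _)).
exists (fun w => \det (M w)); split.
- move=> w i a x y; rewrite -[\det (M (update w i y))]mul1r.
  apply: (@determinant_multilinear _ _ _ _ _ i); rewrite ?row'M //.
  by rewrite !rowM !ffunE eqxx linearP scale1r.
- move=> w i j ij wij; apply: (determinant_alternate ij) => k.
  by rewrite !mxE wij.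
- rewrite /seq_form -[RHS](det1 _ l); congr (\det _); apply/matrixP => i j.
  by rewrite !mxE ffunE TE ?eX ?mem_nth ?sze // mxE index_uniq ?sze.
move=> x xX xe s sz xs.
have il : (index x s < l)%N by rewrite -sz index_mem.
rewrite /seq_form (expand_det_row _ (Ordinal il)) big1 // => j _.
rewrite !mxE ffunE /= nth_index // TE // mxE.
have -> : index x e = l by rewrite -sze; apply/eqP; rewrite eqn_leq index_size leqNgt index_mem.
by rewrite gtn_eqF ?mul0r.
Qed.

End ExteriorForms.

(** * The extremal form and the Pluecker embedding *)

Section Extremal.

Variables (F : finFieldType) (V : vectType F) (n : nat).
Local Notation m := (\dim {:V}).
Local Notation q := #|F|.
Hypothesis nm : (n.+4 <= m)%N.

(** Split a basis of [V] as [a], [x], [y], [z], [w], [c], and add the forms dual to [a], [x], [y]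
    and to [a], [z], [w]. The radical of the sum is the span of [c], of codimension n + 4; the span
    of all but [a] serves as [R] in [weight_le]. *)
Lemma extremal_form : exists h : {ffun 'I_n.+2 -> V} -> F^o,
  [/\ multilinear h, alternating h, ~~ decomposable n.+2 (seq_form h)
    & (q ^ 2 * weight n.+2 (seq_form h) <= (q ^ 2 + 1) * min_weight V n.+2)%N].
Proof.
pose b := vbasis (fullv : {vspace V}).
have bfull := vbasisP (fullv : {vspace V}); have fb := basis_free bfull.
have szb : size b = m by rewrite size_tuple.
have [a [x [y [z [w [c [sza bE]]]]]]] : exists a x y z w c,
    size a = n /\ tval b = a ++ [:: x, y, z, w & c].
  have szd : size (drop n b) = (m - n)%N by rewrite size_drop szb.
  exists (take n b); rewrite -{2}(cat_take_drop n b) size_takel ?szb; last by lia.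
  case: (drop n b) szd => [|x [|y [|z [|w c]]]] /= szd; try by lia.
  by exists x, y, z, w, c.
have szc : (size c + n.+4)%N = m by rewrite -szb bE size_cat /= sza; lia.
pose e1 := a ++ [:: x; y]; pose e2 := a ++ [:: z; w].
have ub := free_uniq fb; rewrite bE in ub fb.
have p1 : perm_eq (a ++ [:: x, y, z, w & c]) (e1 ++ [:: z, w & c]) by rewrite /e1 -catA.
have p2 : perm_eq (a ++ [:: x, y, z, w & c]) (e2 ++ [:: x, y & c]).
  by rewrite /e2 -catA perm_cat2l -[[:: x, _ & _]]/([:: x; y] ++ [:: z; w] ++ c)
       -[_ ++ [:: x, _ & _]]/([:: z; w] ++ [:: x; y] ++ c) perm_catCA.
have f1 : free (e1 ++ [:: z, w & c]) by rewrite -(perm_free p1).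
have f2 : free (e2 ++ [:: x, y & c]) by rewrite -(perm_free p2).
have fR : free [:: x, y, z, w & c] := catr_free fb.
have fc : free c by move: (catr_free f1); rewrite !free_cons => /and3P[].
have sze1 : size e1 = n.+2 by rewrite size_cat sza addn2.
have sze2 : size e2 = n.+2 by rewrite size_cat sza addn2.
have nin1 u : u \in [:: z, w & c] -> u \notin e1.
  by move=> uc; have := free_uniq f1; rewrite cat_uniq => /and3P[_ /hasPn h _]; apply: h.
have nin2 u : u \in [:: x, y & c] -> u \notin e2.
  by move=> uc; have := free_uniq f2; rewrite cat_uniq => /and3P[_ /hasPn h _]; apply: h.
have e1b u : u \in e1 -> u \in e1 ++ [:: z, w & c] by move=> ue; rewrite mem_cat ue.
have e2b u : u \in e2 -> u \in e2 ++ [:: x, y & c] by move=> ue; rewrite mem_cat ue.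
have [h1 [h1M h1A h1e h10]] := dual_form f1 (free_uniq (catl_free f1)) sze1 e1b.
have [h2 [h2M h2A h2e h20]] := dual_form f2 (free_uniq (catl_free f2)) sze2 e2b.
pose h (t : {ffun 'I_n.+2 -> V}) : F^o := h1 t + h2 t.
have hM : multilinear h by move=> v i k u u'; rewrite /h h1M h2M scalerDr addrACA.
have hA : alternating h by move=> v i j ij vij; rewrite /h (h1A _ i j) ?(h2A _ i j) ?addr0.
have F1 := seq_form_altform h1M h1A; have F2 := seq_form_altform h2M h2A.
have FF := seq_form_altform hM hA.
have fE s : seq_form h s = seq_form h1 s + seq_form h2 s by [].
have z1 s u : size s = n.+2 -> u \in s -> u \in [:: z, w & c] -> seq_form h1 s = 0.
  by move=> sz us uc; apply: (h10 u) => //; [rewrite mem_cat uc orbT|exact: nin1].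
have z2 s u : size s = n.+2 -> u \in s -> u \in [:: x, y & c] -> seq_form h2 s = 0.
  by move=> sz us uc; apply: (h20 u) => //; [rewrite mem_cat uc orbT|exact: nin2].
have span0 (G : seq V) (f : seq V -> F) : altform n.+2 f ->
    (forall s u, size s = n.+2 -> u \in s -> u \in G -> f s = 0) ->
    forall v, v \in <<G>>%VS -> forall s, size s = n.+1 -> f (v :: s) = 0.
  move=> fF G0 v /(@coord_span _ _ _ (in_tuple G)) -> s sz.
  rewrite (altform_head_sum _ _ _ fF) // big1 // => i _.
  by rewrite (G0 _ G`_i) ?mulr0 /= ?sz ?inE ?eqxx // mem_nth.
pose R := <<[:: x, y, z, w & c]>>%VS.
(* Each summand vanishes on [P]: the span of some [G] lies in its radical and has codimension [n.+1]
   in [P], less than the degree. *)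
have hyp (f : seq V -> F) (G : seq V) P : altform n.+2 f -> free G -> size G = (size c).+2 ->
    {subset G <= [:: x, y, z, w & c]} ->
    (forall s u, size s = n.+2 -> u \in s -> u \in G -> f s = 0) ->
    (R <= P)%VS -> (\dim P).+1 = m -> vanishes n.+2 f P.
  move=> fF fG szG GR G0 RP dP; apply/negPn/negP => nv.
  have := dim_radical_le fF nv (U := <<G>>%VS); rewrite (eqP fG) szG => le.
  suff : ((size c).+2 + n.+2 <= \dim P)%N by rewrite -ltnS dP -szc !addSn !addnS ltnn.
  apply: le => [|u uG t szt _]; first by apply: subv_trans RP; apply: sub_span.
  exact: (span0 G).
have memB u : (u \in a ++ [:: x, y, z, w & c]) = (u \in e1 ++ [:: z, w & c]) := perm_mem p1 u.
pose B := in_tuple (a ++ [:: x, y, z, w & c]).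
have Bfull : <<a ++ [:: x, y, z, w & c]>>%VS = fullv by rewrite -bE (span_basis bfull).
have vB v : v \in <<B>>%VS by have := memvf v; rewrite -Bfull.
(* Dropping one entry leaves [p] or [r], enough to kill the other summand. *)
have remP p r u : uniq (a ++ [:: p; r]) -> size (a ++ [:: p; r]) = n.+2 ->
    u \in a ++ [:: p; r] -> size (rem u (a ++ [:: p; r])) = n.+1 /\
    exists2 x0, x0 \in [:: p; r] & x0 \in rem u (a ++ [:: p; r]).
  move=> upr szpr uin; split; first by rewrite size_rem // szpr.
  have pr : p != r by move: upr; rewrite cat_uniq /= inE andbT => /and3P[].
  have [up|up] := eqVneq u p.
    by exists r; rewrite ?mem_rem_uniq // !inE ?mem_cat ?inE ?up ?eqxx ?orbT // eq_sym pr.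
  by exists p; rewrite ?mem_rem_uniq // !inE ?mem_cat ?inE ?eqxx ?orbT // eq_sym up.
(* Evaluation at [v] followed by [e] without the [i]-th basis vector isolates that coordinate of
   [v]: there [g1] kills all other basis vectors, and [g2] vanishes. *)
have coef (g1 g2 : seq V -> F) (e : seq V) (i : 'I_(size B)) v :
    altform n.+2 g1 -> (forall s, seq_form h s = g1 s + g2 s) ->
    B`_i \in e -> uniq e -> size e = n.+2 -> g1 e = 1 ->
    (forall u, u \in B -> u \notin e -> forall s, size s = n.+2 -> u \in s -> g1 s = 0) ->
    (forall u, g2 (u :: rem B`_i e) = 0) ->
    (forall s, size s = n.+1 -> seq_form h (v :: s) = 0) -> coord B i v = 0.
  move=> gF hE ie ue sze g1e g10 g20 hv; pose t := rem B`_i e.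
  have szt : size t = n.+1 by rewrite size_rem // sze.
  have g1i : g1 (B`_i :: t) != 0.
    apply/eqP => g0; have := altform_perm gF _ _ g0; rewrite /= szt => /(_ e erefl).
    by rewrite perm_sym perm_to_rem // g1e => /(_ isT) /eqP; rewrite oner_eq0.
  have := altform_head_sum (index_enum _) (fun j => coord B j v) (fun j => B`_j) FF szt.
  rewrite -(coord_span (vB v)) hv // (bigD1 i) //= => /esym.
  rewrite hE g20 addr0 big1 ?addr0.
    by move/eqP; rewrite mulf_eq0 (negPf g1i) orbF => /eqP.
  move=> j ji; rewrite hE g20 addr0.
  have jB : B`_j \in B by rewrite mem_nth // size_tuple.
  case: (boolP (B`_j \in e)) => je; last by rewrite (g10 _ jB) ?mulr0 ?inE ?eqxx //= szt.
  have Bji : B`_j != B`_i by rewrite (nth_uniq 0 _ _ ub) ?ltn_ord.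
  by case: gF => _ ->; rewrite ?mulr0 //= ?szt // mem_rem_uniq // !inE je Bji.
exists h; split=> //.
  suff le : (\dim (radical n.+2 (seq_form h) fullv) <= size c)%N.
    by rewrite /decomposable -ltnNge -szc (leq_ltn_trans (leq_add le (leqnn _))) // ltn_add2l.
  apply: leq_trans (dim_span c); apply: dimvS; apply/subvP => v /(radicalP _ FF) hv.
  rewrite (coord_span (vB v)); apply: memv_suml => i _.
  have [ic|ic] := boolP (B`_i \in c); first by rewrite memvZ // memv_span.
  suff -> : coord B i v = 0 by rewrite scale0r mem0v.
  have [i1|i1] := boolP (B`_i \in e1).
    apply: (coef _ _ e1 i v F1 fE) => //; first exact: free_uniq (catl_free f1).
      by move=> u uB; apply: h10; rewrite -memB.
    have [szr [x0 x0p x0r]] := remP _ _ _ (free_uniq (catl_free f1)) sze1 i1.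
    move=> u; apply: (z2 _ x0); rewrite /= ?szr // ?inE ?x0r ?orbT //.
    by move: x0p; rewrite !inE => /orP[] ->; rewrite ?orbT.
  have iB : B`_i \in B by rewrite mem_nth // size_tuple.
  have i2 : B`_i \in e2.
    move: iB ic i1; rewrite /e1 /e2 !mem_cat !inE.
    by do ![case: (_ == _) => //=]; case: (_ \in a) => //= ->.
  apply: (coef _ _ e2 i v F2 _) => //.
  - by move=> s; rewrite fE addrC.
  - exact: free_uniq (catl_free f2).
  - by move=> u uB; apply: h20; rewrite -(perm_mem p2).
  have [szr [x0 x0p x0r]] := remP _ _ _ (free_uniq (catl_free f2)) sze2 i2.
  move=> u; apply: (z1 _ x0); rewrite /= ?szr // ?inE ?x0r ?orbT //.
  by move: x0p; rewrite !inE => /orP[] ->; rewrite ?orbT.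
have dR : (\dim R + n)%N = m by rewrite (eqP fR) /= -szc !addSn !addnS.
apply: (weight_le FF dR nm) => [|P RP dP].
  rewrite -szc leq_add2r -(eqP fc); apply: dimvS; apply/subvP => v vc.
  apply/radicalP => //; apply: (span0 c) => // s u sz us uc.
  by rewrite fE (z1 _ u) ?(z2 _ u) ?addr0 // !inE uc !orbT.
apply/vanishesP => s sz sP; rewrite fE.
have g1 := hyp _ [:: z, w & c] P F1 (catr_free f1) erefl _ z1 RP dP.
have g2 := hyp _ [:: x, y & c] P F2 (catr_free f2) erefl _ z2 RP dP.
rewrite (vanishesP _ _ _ (g1 _)) ?(vanishesP _ _ _ (g2 _)) ?addr0 //.
  by move=> u; rewrite !inE => /or3P[] ->; rewrite ?orbT.
by move=> u; rewrite !inE => /or3P[] ->; rewrite ?orbT.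
Qed.

End Extremal.

Section Plucker.

Variables (F : finFieldType) (V : vectType F) (k : nat).
Local Notation l := k.+1.
Local Notation q := #|F|.
Variables (W : vectType F) (wedge : {ffun 'I_l -> V} -> W).
Hypothesis hW : is_exterior_power wedge.

Lemma exterior_functional (h : {ffun 'I_l -> V} -> F^o) :
  multilinear h -> alternating h -> exists g : 'Hom(W, F^o), forall w, g (wedge w) = h w.
Proof. by case: hW => _ _ univ hM hA; have [g []] := univ _ h hM hA; exists g. Qed.

Lemma wedge_multilinear (g : 'Hom(W, F^o)) : multilinear (fun w => g (wedge w)).
Proof. by case: hW => wM _ _ w i a x y; rewrite wM linearP. Qed.

Lemma wedge_alternating (g : 'Hom(W, F^o)) : alternating (fun w => g (wedge w)).
Proof. by case: hW => _ wA _ w i j ij wij; rewrite (wA w i j) // linear0. Qed.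

Definition wedge_form (g : 'Hom(W, F^o)) := seq_form (fun w => g (wedge w)).

Lemma wedge_form_altform g : altform l (wedge_form g).
Proof. apply: seq_form_altform; [exact: wedge_multilinear|exact: wedge_alternating]. Qed.

(** If the form vanishes, [g] and 0 both factor the zero map through [wedge], so they agree by
    uniqueness in the universal property. *)
Lemma wedge_form_neq0 g : lker g != fullv -> ~~ vanishes l (wedge_form g) fullv.
Proof.
apply: contra => /vanishesP g0; case: hW => _ _ univ.
have gw w : g (wedge w) = 0.
  have sz : size [seq w i | i <- enum 'I_l] = l by rewrite size_map size_enum_ord.
  rewrite -(g0 _ sz) => [|x _]; last exact: memvf.
  congr (g (wedge _)); apply/ffunP => i.
  by rewrite ffunE (nth_map i) ?size_enum_ord // nth_ord_enum.
have [|| g1 [_ uniq1]] := univ (F^o : vectType F) (fun _ => 0).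
- by move=> w i a x y; rewrite scaler0 addr0.
- by [].
have <- : g1 = g by exact: uniq1.
have -> : g1 = 0 by apply: uniq1 => w; rewrite zero_lfunE.
by rewrite eqEsubv subvf /=; apply/subvP => x _; rewrite memv_ker zero_lfunE.
Qed.

Lemma wedge_form_vanishes g (L : {vspace V}) : \dim L = l ->
  (plucker wedge L <= lker g)%VS = vanishes l (wedge_form g) L.
Proof.
move=> dL; have szL : size (vbasis L) = l by rewrite size_tuple.
rewrite /plucker -memvE memv_ker -[g _]/(wedge_form g (vbasis L)).
apply/eqP/idP => [g0|/vanishesP]; last by apply=> // x /vbasis_mem.
by rewrite -(span_basis (vbasisP L)); apply: vanishes_span => //; apply: wedge_form_altform.
Qed.

(** For [z] in [L'] outside [L], extend a basis of [L] by [z]. The form dual to the basis of [L] is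
    nonzero on [L] but vanishes on [L'], where [z] is in its radical, so a hyperplane separates the
    two points. *)
Lemma plucker_inj (L L' : {vspace V}) : \dim L = l -> \dim L' = l ->
  plucker wedge L = plucker wedge L' -> L = L'.
Proof.
move=> dL dL' pLL'; apply/eqP; rewrite eq_sym eqEdim dL dL' leqnn andbT.
apply/negPn/negP => /subvPn[z zL' zL].
have szL : size (vbasis L) = l by rewrite size_tuple.
have fX : free (z :: vbasis L).
  by rewrite free_cons (span_basis (vbasisP L)) zL (basis_free (vbasisP L)).
have [x xL|h [hM hA h1 h0]] := dual_form fX (free_uniq (basis_free (vbasisP L))) szL.
  by rewrite inE xL orbT.
have [g gh] := exterior_functional hM hA.
have hF := seq_form_altform hM hA.
have hE s : wedge_form g s = seq_form h s by rewrite /wedge_form /seq_form gh.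
have gL : ~~ (plucker wedge L <= lker g)%VS.
  by rewrite /plucker -memvE memv_ker -[g _]/(wedge_form g (vbasis L)) hE h1 oner_eq0.
case/negP: gL; rewrite pLL' wedge_form_vanishes //; apply/negPn/negP => nv.
have := dim_radical_le (wedge_form_altform g) nv (U := <[z]>%VS); rewrite -memvE zL' dL' => le.
have z0 : z != 0 by apply: contraNneq zL => ->; rewrite mem0v.
suff : (\dim <[z]> + l <= l)%N by rewrite dim_vline z0 add1n ltnn.
apply: le => // u /vlineP[a ->] t szt _.
rewrite (altform_headZ (wedge_form_altform g)) // hE.
rewrite (h0 z) ?mulr0 ?inE ?eqxx //= ?szt //.
by apply: contra zL => /vbasis_mem.
Qed.

(** By [plucker_inj] points may be counted as subspaces, and those on the kernel of [g] are the ones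
    on which the form vanishes. *)
Lemma card_points g :
  (#|points_on (lker g) (grassmannian wedge)| + #|nonvanishing_spaces l (wedge_form g)|)%N
   = #|[set L : {vspace V} | \dim L == l]|.
Proof.
pose A := [set L : {vspace V} | \dim L == l]; pose B := nonvanishing_spaces l (wedge_form g).
have -> : points_on (lker g) (grassmannian wedge) = plucker wedge @: (A :\: B).
  apply/setP => P; rewrite inE; apply/andP/imsetP => [[/imsetP[L dL ->] Pg]|[L LAB ->]].
    rewrite inE in dL; exists L => //; rewrite !inE dL andbT /=.
    by rewrite -wedge_form_vanishes ?Pg //; exact/eqP.
  move: LAB; rewrite !inE => /andP[nB /eqP dL]; split.
    by apply/imsetP; exists L; rewrite ?inE ?dL.
  by rewrite wedge_form_vanishes //; move: nB; rewrite dL eqxx negbK.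
rewrite card_in_imset => [|L L']; last first.
  by rewrite !inE => /andP[_ /eqP dL] /andP[_ /eqP dL']; exact: plucker_inj.
have BA : B \subset A by apply/subsetP => L; rewrite !inE => /andP[].
by rewrite -/B cardsDS // subnK // subset_leq_card.
Qed.

Lemma hyperplane_functional (H : {vspace W}) : hyperplane H ->
  exists g : 'Hom(W, F^o), lker g = H.
Proof.
rewrite /hyperplane => dH.
have /subvPn[w _ wH] : ~~ (fullv <= H)%VS by apply/negP => /dimvS; rewrite -dH ltnn.
have fX : free (w :: vbasis H).
  by rewrite free_cons (span_basis (vbasisP H)) wH (basis_free (vbasisP H)).
have [T /(_ fX)] := linear_of_free (w :: vbasis H) ((1 : F^o) :: nseq (\dim H) 0).
rewrite /= size_nseq size_tuple => /(_ erefl) [Tw TH].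
exists (linfun T); apply/esym/eqP; rewrite eqEdim; apply/andP; split.
  rewrite -(span_basis (vbasisP H)); apply/span_subvP => u uH.
  rewrite memv_ker lfunE; have : T u \in [seq T i | i <- vbasis H] by exact: map_f.
  by rewrite /= TH mem_nseq => /andP[].
rewrite -ltnS dH ltnNge; apply/negP => d.
have : w \in lker (linfun T).
  by have /eqP -> : lker (linfun T) == fullv; rewrite ?memvf // eqEdim subvf.
by rewrite memv_ker lfunE /= Tw oner_eq0.
Qed.

Lemma lker_hyperplane (g : 'Hom(W, F^o)) : lker g != fullv -> hyperplane (lker g).
Proof.
move=> g0; rewrite /hyperplane -(limg_ker_dim g fullv) capfv -addn1; congr addn.
apply/eqP; rewrite eq_sym eqn_leq (leq_trans (dimvS (subvf _))) ?dimvf //=.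
rewrite lt0n dimv_eq0; apply: contra g0; rewrite -subv0 => /subvP gW.
rewrite eqEsubv subvf; apply/subvP => x _.
by rewrite memv_ker -memv0 gW // memv_img // memvf.
Qed.

End Plucker.

(** * Gaussian binomials and the final count *)

Lemma eq_nonvanishing_spaces (F : finFieldType) (V : vectType F) l (f g : seq V -> F) :
  f =1 g -> nonvanishing_spaces l f = nonvanishing_spaces l g.
Proof.
move=> fg; apply/setP => L; rewrite !inE; congr (_ && ~~ _).
by apply: eq_forallb => t; rewrite fg.
Qed.

Lemma hyperplane_neq_fullv (F : finFieldType) (W : vectType F) (H : {vspace W}) :
  hyperplane H -> H != fullv.
Proof. by move=> dH; apply: contra_eqN dH => /eqP ->; rewrite gtn_eqF. Qed.

Lemma gauss_binomialE (F : finFieldType) (V : vectType F) (k : nat) : (k <= \dim {:V})%N ->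
  gauss_binomial #|F| (\dim {:V}) k = #|[set L : {vspace V} | \dim L == k]|%:R.
Proof.
move=> km; rewrite /gauss_binomial prodf_div.
have cast d : (k <= d)%N ->
    \prod_(i < k) ((#|F|%:R : rat) ^+ d - #|F|%:R ^+ i) = (nbases F k d)%:R.
  move=> kd; rewrite /nbases natr_prod; apply: eq_bigr => i _.
  rewrite natrB ?natrX // leq_exp2l ?finNzRing_gt1 //.
  exact: leq_trans (ltnW (ltn_ord i)) kd.
rewrite !cast // -card_grassmannian natrM mulfK // pnatr_eq0 -lt0n nbases_gt0 //.
Qed.

Section Main.

Variables (F : finFieldType) (V : vectType F) (n : nat).
Local Notation m := (\dim {:V}).
Local Notation q := #|F|.
Local Notation delta := (n.+2 * (m - n.+2))%N.
Hypothesis nm : (n.+4 <= m)%N.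

Let n2m : (n.+2 <= m)%N. Proof. by rewrite (leq_trans _ nm) // ltnW. Qed.

Let delta_ge2 : (2 <= delta)%N.
Proof. by rewrite mulSn (leq_trans _ (leq_addr _ _)) // leq_subRL // addn2. Qed.

Lemma card_nonvanishing_decomposable f :
  altform n.+2 f -> ~~ vanishes n.+2 f (fullv : {vspace V}) ->
  decomposable n.+2 f -> #|nonvanishing_spaces n.+2 f| = (q ^ delta)%N.
Proof.
move=> fF nv df; have := weight_decomposable fF nv (fun _ => df).
rewrite weightE // min_weightE // => /eqP.
by rewrite eqn_pmul2r ?nbases_gt0 // => /eqP.
Qed.

Let pow_delta : (q ^ delta = q ^ 2 * q ^ (delta - 2))%N.
Proof. by rewrite -expnD subnKC. Qed.

Let q2_gt0 : (0 < q ^ 2)%N. Proof. by rewrite expn_gt0 ltnW // finNzRing_gt1. Qed.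

Lemma card_nonvanishing_ge f : altform n.+2 f -> ~~ @decomposable F V n.+2 f ->
  (q ^ delta + q ^ (delta - 2) <= #|nonvanishing_spaces n.+2 f|)%N.
Proof.
move=> fF nd; have := weight_nondecomposable_ge fF nd.
rewrite weightE // min_weightE // !mulnA leq_pmul2r ?nbases_gt0 //.
by rewrite pow_delta mulnCA leq_pmul2l // mulnDl mul1n.
Qed.

Lemma card_nonvanishing_le f : altform n.+2 f ->
  (q ^ 2 * weight n.+2 f <= (q ^ 2 + 1) * min_weight V n.+2)%N ->
  (#|@nonvanishing_spaces F V n.+2 f| <= q ^ delta + q ^ (delta - 2))%N.
Proof.
move=> fF; rewrite weightE // min_weightE // !mulnA leq_pmul2r ?nbases_gt0 //.
by rewrite pow_delta mulnCA leq_pmul2l // mulnDl mul1n.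
Qed.

End Main.

Theorem theorem4p10 (F : finFieldType) (q : nat) (hq : #|F| = q)
    (l m : nat) (hl : (2 <= l)%N) (hlm : (l + 2 <= m)%N)
    (V : vectType F) (hV : \dim {:V} = m)
    (W : vectType F) (wedge : {ffun 'I_l -> V} -> W)
    (hW : is_exterior_power wedge) :
  (forall H : {vspace W}, hyperplane H ->
     #|points_on H (grassmannian wedge)|%:R < e_bound q l m ->
     #|points_on H (grassmannian wedge)|%:R <= e'_bound q l m) /\
  (exists H : {vspace W}, hyperplane H /\
     #|points_on H (grassmannian wedge)|%:R = e'_bound q l m).
Proof.
case: l => [|[|n]] // in hl hlm wedge hW *; subst q m.
have nm : (n.+4 <= \dim {:V})%N by rewrite -[n.+4]addn2.
have pE g := card_points hW g.
have gE : gauss_binomial #|F| (\dim {:V}) n.+2 = #|[set L : {vspace V} | \dim L == n.+2]|%:R.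
  by apply: gauss_binomialE; rewrite (leq_trans _ nm) // ltnW.
split=> [H hH|].
  have [g gH] := hyperplane_functional hH.
  have gF := wedge_form_altform hW g.
  have nv : ~~ vanishes n.+2 (wedge_form wedge g) fullv.
    by apply: (wedge_form_neq0 hW); rewrite gH hyperplane_neq_fullv.
  (* The assumption now says that more than q^(l(m-l)) subspaces lie off [H], whereas a decomposable
     form gives exactly that many. *)
  rewrite /e_bound /e'_bound gE -gH -(pE g) natrD -!natrX -addrA ltrDl => lt.
  have [d|nd] := boolP (decomposable n.+2 (wedge_form wedge g)).
    by move: lt; rewrite (card_nonvanishing_decomposable nm gF nv d) subrr ltxx.
  rewrite -!addrA lerDl -opprD subr_ge0 -natrD ler_nat.
  exact: card_nonvanishing_ge.
have [h [hM hA nd le]] := extremal_form nm.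
have [g gh] := exterior_functional hW hM hA.
have hF := seq_form_altform hM hA.
have gfE s : wedge_form wedge g s = seq_form h s by exact: gh.
exists (lker g); split.
  apply: lker_hyperplane; apply: contra (nondecomposable_neq0 hF nd) => /eqP g0.
  apply/vanishesP => s _ _; rewrite -gfE.
  have : wedge [ffun i : 'I_n.+2 => s`_i] \in lker g by rewrite g0 memvf.
  by rewrite memv_ker => /eqP.
rewrite /e'_bound gE -(pE g) natrD (eq_nonvanishing_spaces _ gfE).
have -> : #|nonvanishing_spaces n.+2 (seq_form h)| =
    (#|F| ^ (n.+2 * (\dim {:V} - n.+2)) + #|F| ^ (n.+2 * (\dim {:V} - n.+2) - 2))%N.
  by apply/eqP; rewrite eqn_leq card_nonvanishing_le // card_nonvanishing_ge.
by rewrite natrD !natrX -[RHS]addrA -opprD addrK.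
Qed.
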